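(* Let $\mathcal{M}$ be an o-minimal structure on the real field. Let $p\in\mathbb{N}_0$ and let $A\subset\mathbb{R}^p\times\mathbb{R}$ be definable in $\mathcal{M}$. For $u\in\mathbb{R}^p$ set $A_u:=\{x\in\mathbb{R}\mid (u,x)\in A\}$. Then the parameterized integral $$\mathbb{R}^p\times\mathbb{R}\times\mathbb{R}_{>0}\to[0,1],\quad (u,a,t)\mapsto P_a(B_t\in A_u)=\frac{1}{\sqrt{2\pi t}}\int_{A_u}e^{-\frac{(x-a)^2}{2t}}\,dx,$$ is definable in the Pfaffian closure $\mathcal{P}(\mathcal{M})$ of $\mathcal{M}$.
   Context: $\mathbb{N}_0=\{0,1,2,\ldots\}$ and $\mathbb{R}_{>0}=\{x\in\mathbb{R}\mid x>0\}$. An o-minimal structure on the real field is an o-minimal expansion of the ordered field of reals; definable means definable with parameters from $\mathbb{R}$. $P_a(B_t\in A_u)$ is the probability that one-dimensional Brownian motion $(B_t)_{t\ge 0}$ with start value $a$ lies in $A_u$ at time $t$; for $t>0$ it is given by the displayed Gaussian integral. Pfaffian closure (Speissegger): let $\mathcal{N}$ be an expansion of the real field. Let $U\subset\mathbb{R}^m$ be open and definable in $\mathcal{N}$ and let $\omega=a_1dx_1+\cdots+a_mdx_m$ be a nowhere vanishing 1-form on $U$ whose coefficients $a_i:U\to\mathbb{R}$ are $C^1$ and definable in $\mathcal{N}$. A leaf of $\omega=0$ is a maximal connected immersed $C^1$ submanifold $L$ of $U$ of codimension one with $T_xL=\ker\omega(x)$ for all $x\in L$. A leaf $L$ is a Rolle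 leaf (over $\mathcal{N}$) if it is a closed embedded submanifold of $U$ and for every $C^1$ curve $\gamma:[0,1]\to U$ with $\gamma(0),\gamma(1)\in L$ there is $s\in[0,1]$ with $\omega(\gamma(s))(\gamma'(s))=0$. Put $\mathcal{M}_0:=\mathcal{M}$ and let $\mathcal{M}_{i+1}$ be the expansion of $\mathcal{M}_i$ by all Rolle leaves over $\mathcal{M}_i$. The Pfaffian closure $\mathcal{P}(\mathcal{M})$ is the union of the $\mathcal{M}_i$, $i\in\mathbb{N}_0$; it is again o-minimal. *)

(* Defs.v *)
From HB Require Import structures.
From mathcomp Require Import all_boot all_order all_algebra.
From mathcomp Require Import all_classical all_reals all_analysis.

Set Implicit Arguments.
Unset Strict Implicit.
Unset Printing Implicit Defensive.

Import Order.TTheory GRing.Theory Num.Theory.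
Import numFieldNormedType.Exports.

Local Open Scope classical_set_scope.
Local Open Scope ring_scope.

(* An expansion of the ordered field R is given by its additional primitive
   relations, of every arity; functions are primitive through their graphs,
   and the ordered field operations are built into [formula] below. *)
Definition expansion (R : realType) := forall n : nat, set (set 'rV[R]_n).

(* First-order formulas, with parameters from R, in the language of the
   expansion [N].  Terms are those of MathComp's field language, where
   parameters are the constants [GRing.Const] and 0^-1 = 0; the inverse is
   definable in the field R, so it adds no definable set. *)
Inductive formula (R : realType) (N : expansion R) : Type :=
| Equal of GRing.term R & GRing.term R
| Less of GRing.term R & GRing.term R
| Rel n (S : set 'rV[R]_n) of N n S & ('I_n -> GRing.term R)
| Not of formula N
| And of formula N & formula N
| Exists of nat & formula N.

Fixpoint holds (R : realType) (N : expansion R) (e : seq R) (f : formula N) :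
    Prop :=
  match f with
  | Equal t1 t2 => GRing.eval e t1 = GRing.eval e t2
  | Less t1 t2 => GRing.eval e t1 < GRing.eval e t2
  | @Rel _ _ n E _ ts => E (\row_i GRing.eval e (ts i))
  | Not g => ~ holds e g
  | And g h => holds e g /\ holds e h
  | Exists i g => exists x : R, holds (set_nth 0 e i x) g
  end.

(* Variable number i < n stands for the i-th coordinate; any other free
   variable is read as the parameter 0. *)
Definition definable (R : realType) (N : expansion R) (n : nat)
    (A : set 'rV[R]_n) : Prop :=
  exists f : formula N,
    A = [set v | holds [seq v ord0 i | i <- enum 'I_n] f].

(* The function D -> R obtained by restricting f to D: its graph is definable. *)
Definition definable_fun (R : realType) (N : expansion R) (n : nat)
    (D : set 'rV[R]_n) (f : 'rV[R]_n -> R) : Prop :=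
  definable N [set z : 'rV[R]_(n + 1) |
    D (lsubmx z) /\ rsubmx z ord0 ord0 = f (lsubmx z)].

(* [interval R] comprises the points as well as the bounded and unbounded
   intervals. *)
Definition o_minimal (R : realType) (N : expansion R) : Prop :=
  forall S : set R, definable N [set v : 'rV[R]_1 | S (v ord0 ord0)] ->
    exists s : seq (interval R), S = \big[setU/set0]_(I <- s) [set` I].

Definition C1_on (R : realType) (k m : nat) (W : set 'rV[R]_k)
    (f : 'rV[R]_k -> 'rV[R]_m) : Prop :=
  forall x, W x ->
    differentiable f x /\ forall v, {for x, continuous ('D_v f)}.

(* A 1-form a_1 dx_1 + ... + a_m dx_m is given by its row of coefficients. *)
Definition form_app (R : realType) (m : nat) (a : 'rV[R]_m -> 'rV[R]_m)
    (x v : 'rV[R]_m) : R :=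
  \sum_(i < m) a x ord0 i * v ord0 i.

(* phi is a homeomorphism of the open set W onto an open subset of X, and
   iota \o phi is a C^1 immersion on W. *)
Definition local_param (R : realType) (k m : nat) (X : topologicalType)
    (iota : X -> 'rV[R]_m) (W : set 'rV[R]_k) (phi : 'rV[R]_k -> X) : Prop :=
  [/\ open W /\ {in W &, injective phi},
      forall w, W w -> {for w, continuous phi},
      forall O, open O -> O `<=` W -> open (phi @` O),
      C1_on W (iota \o phi) &
      forall w, W w -> injective ('d (iota \o phi) w)].

(* The image of iota is an immersed C^1 submanifold of dimension k, with X
   carrying its manifold topology.  Since every local parametrization is
   required to be a C^1 immersion after composition with iota, the coordinate
   changes are automatically C^1 (inverse function theorem).  X is
   automatically Hausdorff, as iota is injective and continuous, and, when
   connected, second countable, as it carries a Riemannian metric pulled back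
   from R^m. *)
Definition immersed_submanifold (R : realType) (k m : nat)
    (X : topologicalType) (iota : X -> 'rV[R]_m) : Prop :=
  injective iota /\
  forall x : X, exists (W : set 'rV[R]_k) (phi : 'rV[R]_k -> X),
    local_param iota W phi /\ (phi @` W) x.

Definition tangent_space (R : realType) (k m : nat) (X : topologicalType)
    (iota : X -> 'rV[R]_m) (x : X) : set 'rV[R]_m :=
  [set v | exists (W : set 'rV[R]_k) (phi : 'rV[R]_k -> X) (w : 'rV[R]_k),
     [/\ local_param iota W phi, W w, phi w = x &
         range ('d (iota \o phi) w) v]].

(* Codimension one is dimension m.-1; for m = 0 there is no nowhere vanishing
   1-form on a nonempty U, so the truncation of m.-1 is harmless. *)
Definition integral_manifold (R : realType) (m : nat) (U : set 'rV[R]_m)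
    (a : 'rV[R]_m -> 'rV[R]_m) (X : topologicalType) (iota : X -> 'rV[R]_m) :
    Prop :=
  [/\ immersed_submanifold m.-1 iota,
      range iota !=set0, connected [set: X], range iota `<=` U &
      forall x : X, tangent_space m.-1 iota x =
                    [set v | form_app a (iota x) v = 0]].

Definition is_leaf (R : realType) (m : nat) (U : set 'rV[R]_m)
    (a : 'rV[R]_m -> 'rV[R]_m) (X : topologicalType) (iota : X -> 'rV[R]_m) :
    Prop :=
  integral_manifold U a iota /\
  forall (Y : topologicalType) (kappa : Y -> 'rV[R]_m),
    integral_manifold U a kappa -> range iota `<=` range kappa ->
    range kappa = range iota.

(* iota is a homeomorphism onto its image. *)
Definition embedding (R : realType) (m : nat) (X : topologicalType)
    (iota : X -> 'rV[R]_m) : Prop :=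
  injective iota /\
  forall O : set X, open O <-> exists2 V, open V & O = iota @^-1` V.

(* gamma' is the derivative of gamma on [0, 1], one-sided at the endpoints. *)
Definition C1_curve (R : realType) (m : nat) (gamma gamma' : R -> 'rV[R]_m) :
    Prop :=
  (forall s, s \in `[0, 1] ->
     (fun r => (r - s)^-1 *: (gamma r - gamma s))
       @ within [set` `[0, 1]] s^' --> gamma' s) /\
  {within [set` `[0, 1]], continuous gamma'}.

Definition rolle_condition (R : realType) (m : nat) (U : set 'rV[R]_m)
    (a : 'rV[R]_m -> 'rV[R]_m) (L : set 'rV[R]_m) : Prop :=
  forall gamma gamma' : R -> 'rV[R]_m, C1_curve gamma gamma' ->
    (forall s, s \in `[0, 1] -> U (gamma s)) ->
    L (gamma 0) -> L (gamma 1) ->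
    exists2 s, s \in `[0, 1] & form_app a (gamma s) (gamma' s) = 0.

Definition rolle_leaf (R : realType) (m : nat) (U : set 'rV[R]_m)
    (a : 'rV[R]_m -> 'rV[R]_m) (L : set 'rV[R]_m) : Prop :=
  exists (X : topologicalType) (iota : X -> 'rV[R]_m),
    [/\ L = range iota, is_leaf U a iota, embedding iota,
        closure L `&` U `<=` L & rolle_condition U a L].

(* Only the values on U of the coefficients a matter. *)
Definition rolle_leaf_over (R : realType) (N : expansion R) (m : nat)
    (L : set 'rV[R]_m) : Prop :=
  exists (U : set 'rV[R]_m) (a : 'rV[R]_m -> 'rV[R]_m),
    [/\ open U /\ definable N U,
        forall i, definable_fun N U (fun x => a x ord0 i),
        C1_on U a,
        forall x, U x -> a x != 0 &
        rolle_leaf U a L].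

Definition add_rolle_leaves (R : realType) (N : expansion R) : expansion R :=
  fun n => [set S | N n S \/ rolle_leaf_over N S].

Definition pfaffian_closure (R : realType) (M : expansion R) : expansion R :=
  fun n => [set S | exists i : nat, iter i (@add_rolle_leaves R) M n S].

(* One-dimensional Brownian motion with start value a; only the times t >= 0
   are relevant. *)
Definition brownian_motion (R : realType) (d : measure_display)
    (T : measurableType d) (P : probability T R) (a : R) (B : R -> T -> R) :
    Prop :=
  [/\ forall t, 0 <= t -> measurable_fun [set: T] (B t),
      {ae P, forall w, B 0 w = a},
      forall s t, 0 <= s < t -> forall E, measurable E ->
        P [set w | E (B t w - B s w)] = normal_prob 0 (Num.sqrt (t - s)) E,
      forall (n : nat) (tau : nat -> R) (E : nat -> set R),
        0 <= tau 0%N -> {homo tau : i j / (i <= j)%N >-> i <= j} ->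
        (forall i, measurable (E i)) ->
        P [set w | forall i, (i < n)%N -> E i (B (tau i.+1) w - B (tau i) w)] =
        (\prod_(i < n) P [set w | E i (B (tau i.+1) w - B (tau i) w)%R])%E &
      {ae P, forall w,
         {within [set` `[0, +oo[], continuous (fun t : R => B t w)}}].

(* R^p x R is 'rV_(p + 1), the last coordinate being the second factor. *)
Definition slice (R : realType) (p : nat) (A : set 'rV[R]_(p + 1))
    (u : 'rV[R]_p) : set R :=
  [set x | A (row_mx u x%:M)].

Definition gauss_integral_on (R : realType) (E : set R) (a t : R) : R :=
  (Num.sqrt (2 * pi * t))^-1 *
  \int[lebesgue_measure]_(x in E) expR (- ((x - a) ^+ 2 / (2 * t))).

(* Main.v *)
From HB Require Import structures.
Require Import Defs.
From mathcomp Require Import all_boot all_order all_algebra.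
From mathcomp Require Import all_classical all_reals all_analysis.
From mathcomp Require Import measurable_realfun ring lra zify.

Set Implicit Arguments.
Unset Strict Implicit.
Unset Printing Implicit Defensive.
Import Order.TTheory GRing.Theory Num.Theory.
Import numFieldNormedType.Exports.

Local Open Scope classical_set_scope.
Local Open Scope ring_scope.

(** For a fixed base point [u] the slice [slice A u] is, by o-minimality, a finite
    union of points and intervals.  Up to a null set it is therefore a union of
    some of the intervals between its consecutive jumps, and the integral is a
    sum of differences [Phi ((y' - a) / sqrt t) - Phi ((y - a) / sqrt t)], where
    [Phi] is the distribution function of the standard normal law and [y], [y']
    are jumps or infinite ([mass_specP]).  So there are two things to prove.

    The function [Phi] is definable in the Pfaffian closure ([defn_Phi]).  The
    Gaussian density solves [y' = - x * y], so its graph is a level set of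
    [y * exp (x^2 / 2)], a first integral of [dy + x * y dx], and hence a Rolle
    leaf over any structure ([density_leaf]).  After this graph has been added,
    the graph of [Phi] is a level set of the first integral [y - Phi x] of
    [dy - density x dx], a form with definable coefficients, and so it is added
    at the second stage ([Phi_leaf]).  The reason why such graphs are Rolle
    leaves is in [rolle_leaf_graph].

    The number of jumps of the slices is bounded uniformly in [u], so that a
    single formula describes all of these sums.  This is uniform finiteness
    ([uniform_finiteness]).  Over the real numbers it has a short proof without
    cell decomposition, by induction on the number of parameters: a definable
    family of finite sets, indexed by one real parameter, varies continuously
    outside the countably many jumps of countably many definable sets
    ([stable_cocountable]), and a countable definable set of reals is finite.

    Definability is handled through predicates on environments
    [e : nat -> R], which are closed under substitution of terms
    ([defn_subst]) and quantification ([defn_ex]). *)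

(** * Definable predicates *)

Section Syntax.
Variables (R : realType) (N : expansion R).
Implicit Types (f g : formula N) (t : GRing.term R).

Fixpoint var_bound f : nat :=
  match f with
  | Equal t1 t2 | Less t1 t2 => maxn (GRing.ub_var t1) (GRing.ub_var t2)
  | @Rel _ _ n _ _ ts => \max_(i < n) GRing.ub_var (ts i)
  | Not g => var_bound g
  | And g h => maxn (var_bound g) (var_bound h)
  | Exists i g => maxn i.+1 (var_bound g)
  end.

Lemma eval_eq_env (e e' : seq R) t :
  (forall i, (i < GRing.ub_var t)%N -> e`_i = e'`_i) ->
  GRing.eval e t = GRing.eval e' t.
Proof.
elim: t => //=.
- by move=> n; apply.
- by move=> t1 IH1 t2 IH2 H; congr (_ + _); [apply: IH1 | apply: IH2] => i Hi;
    apply: H; rewrite leq_max Hi ?orbT.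
- by move=> t1 IH1 H; congr (- _); exact: IH1.
- by move=> t1 IH1 n H; congr (_ *+ _); exact: IH1.
- by move=> t1 IH1 t2 IH2 H; congr (_ * _); [apply: IH1 | apply: IH2] => i Hi;
    apply: H; rewrite leq_max Hi ?orbT.
- by move=> t1 IH1 H; congr (_ ^-1); exact: IH1.
- by move=> t1 IH1 n H; congr (_ ^+ _); exact: IH1.
Qed.

Lemma holds_eq_env f (e e' : seq R) :
  (forall i, (i < var_bound f)%N -> e`_i = e'`_i) ->
  holds e f <-> holds e' f.
Proof.
elim: f e e' => [t1 t2|t1 t2|n S E ts|g IH|g IHg h IHh|k g IH] e e' /= H.
- by rewrite (@eval_eq_env e e' t1) ?(@eval_eq_env e e' t2) // => i Hi; apply: H;
    rewrite leq_max Hi ?orbT.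
- by rewrite (@eval_eq_env e e' t1) ?(@eval_eq_env e e' t2) // => i Hi; apply: H;
    rewrite leq_max Hi ?orbT.
- suff -> : \row_i GRing.eval e (ts i) = \row_i GRing.eval e' (ts i) by [].
  apply/rowP => i; rewrite !mxE; apply: eval_eq_env => j Hj; apply: H.
  exact: (leq_trans Hj (leq_bigmax (F := fun i => GRing.ub_var (ts i)) i)).
- by rewrite (IH e e').
- by rewrite (IHg e e') ?(IHh e e') // => i Hi; apply: H; rewrite leq_max Hi ?orbT.
- have E x : holds (set_nth 0 e k x) g <-> holds (set_nth 0 e' k x) g.
    apply: IH => i Hi; rewrite !nth_set_nth /=; case: eqP => // _.
    by apply: H; rewrite leq_max Hi orbT.
  by split=> -[x Hx]; exists x; apply/E.
Qed.

Fixpoint subst_term (s : nat -> GRing.term R) t : GRing.term R :=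
  match t with
  | GRing.Var i => s i
  | GRing.Const c => GRing.Const c
  | GRing.NatConst n => GRing.NatConst _ n
  | GRing.Add t1 t2 => GRing.Add (subst_term s t1) (subst_term s t2)
  | GRing.Opp t1 => GRing.Opp (subst_term s t1)
  | GRing.NatMul t1 n => GRing.NatMul (subst_term s t1) n
  | GRing.Mul t1 t2 => GRing.Mul (subst_term s t1) (subst_term s t2)
  | GRing.Inv t1 => GRing.Inv (subst_term s t1)
  | GRing.Exp t1 n => GRing.Exp (subst_term s t1) n
  end.

Lemma eval_subst_term s t (e : seq R) n : (GRing.ub_var t <= n)%N ->
  GRing.eval e (subst_term s t) =
  GRing.eval (mkseq (fun i => GRing.eval e (s i)) n) t.
Proof.
elim: t => //=.
- by move=> i Hi; rewrite nth_mkseq.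
- by move=> t1 IH1 t2 IH2; rewrite geq_max => /andP[/IH1-> /IH2->].
- by move=> t1 IH1 /IH1->.
- by move=> t1 IH1 k /IH1->.
- by move=> t1 IH1 t2 IH2; rewrite geq_max => /andP[/IH1-> /IH2->].
- by move=> t1 IH1 /IH1->.
- by move=> t1 IH1 k /IH1->.
Qed.

(** Capture is avoided by renaming the bound variable of each quantifier to an
    index beyond all variables of the terms substituted below it. *)
Lemma subst_formula f (s : nat -> GRing.term R) : exists f', forall e,
  holds e f' <->
  holds (mkseq (fun i => GRing.eval e (s i)) (var_bound f)) f.
Proof.
elim: f s => [t1 t2|t1 t2|n S E ts|g IH|g IHg h IHh|k g IH] s /=.
- exists (Equal N (subst_term s t1) (subst_term s t2)) => e /=.
  by rewrite !(eval_subst_term _ _ (n := maxn (GRing.ub_var t1) (GRing.ub_var t2)))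
    ?leq_maxl ?leq_maxr.
- exists (Less N (subst_term s t1) (subst_term s t2)) => e /=.
  by rewrite !(eval_subst_term _ _ (n := maxn (GRing.ub_var t1) (GRing.ub_var t2)))
    ?leq_maxl ?leq_maxr.
- exists (Rel E (fun i => subst_term s (ts i))) => e /=.
  set v := (X in S X <-> _); set w := (X in _ <-> S X).
  suff -> : v = w by [].
  apply/rowP => i; rewrite !mxE; apply: eval_subst_term.
  exact: (leq_bigmax (F := fun i => GRing.ub_var (ts i)) i).
- by have [g' Hg'] := IH s; exists (Not g') => e /=; rewrite Hg'.
- have [g' Hg'] := IHg s; have [h' Hh'] := IHh s.
  exists (And g' h') => e /=; rewrite Hg' Hh'.
  by split=> -[H1 H2]; split; (apply/holds_eq_env; [| by [exact: H1 | exact: H2]]);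
    move=> i Hi; rewrite !nth_mkseq // leq_max Hi ?orbT.
- pose m := \max_(i < var_bound g) GRing.ub_var (s i).
  have [g' Hg'] := IH (fun i => if i == k then GRing.Var _ m else s i).
  exists (Exists m g') => e /=.
  suff H x : holds (set_nth 0 e m x) g' <->
      holds (set_nth 0 (mkseq (fun i => GRing.eval e (s i))
        (maxn k.+1 (var_bound g))) k x) g.
    by split=> -[x Hx]; exists x; apply/H.
  rewrite Hg'; apply: holds_eq_env => i Hi.
  rewrite nth_mkseq // nth_set_nth /=; case: eqP => [_|_] /=.
    by rewrite nth_set_nth /= eqxx.
  rewrite nth_mkseq; last by rewrite leq_max Hi orbT.
  apply: eval_eq_env => j Hj; rewrite nth_set_nth /=; case: eqP => // jm.
  have := leq_bigmax (F := fun i : 'I_(var_bound g) => GRing.ub_var (s i)) (Ordinal Hi).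
  by rewrite /= -/m -jm leqNgt Hj.
Qed.

End Syntax.

Section Calculus.
Variables (R : realType) (N : expansion R).
Implicit Types (e : nat -> R).

(** Predicates of infinitely many real variables replace sets of row vectors, so
    that all definable predicates live in one type and de Bruijn indices can be
    used.  The long initial segments make such a predicate depend on finitely
    many variables only. *)
Definition defn_pred (P : (nat -> R) -> Prop) : Prop :=
  exists (f : formula N) (B : nat), forall n e, (B <= n)%N ->
    holds (mkseq e n) f <-> P e.

Definition defn_term (t : (nat -> R) -> R) : Prop :=
  exists (tt : GRing.term R) (B : nat), forall n e, (B <= n)%N ->
    GRing.eval (mkseq e n) tt = t e.

Definition env_cons (x : R) e : nat -> R := fun i => if i is j.+1 then e j else x.

Lemma defn_term_var i : defn_term (fun e => e i).
Proof. by exists (GRing.Var _ i), i.+1 => n e Hn /=; rewrite nth_mkseq. Qed.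

Lemma defn_term_cst c : defn_term (fun=> c).
Proof. by exists (GRing.Const c), 0%N. Qed.

Lemma defn_term_add t1 t2 : defn_term t1 -> defn_term t2 ->
  defn_term (fun e => t1 e + t2 e).
Proof.
move=> [a [m Ha]] [b [n Hb]]; exists (GRing.Add a b), (maxn m n) => k e.
by rewrite geq_max /= => /andP[/Ha-> /Hb->].
Qed.

Lemma defn_term_mul t1 t2 : defn_term t1 -> defn_term t2 ->
  defn_term (fun e => t1 e * t2 e).
Proof.
move=> [a [m Ha]] [b [n Hb]]; exists (GRing.Mul a b), (maxn m n) => k e.
by rewrite geq_max /= => /andP[/Ha-> /Hb->].
Qed.

Lemma defn_term_opp t : defn_term t -> defn_term (fun e => - t e).
Proof. by move=> [a [m Ha]]; exists (GRing.Opp a), m => k e /= /Ha->. Qed.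

Lemma defn_term_inv t : defn_term t -> defn_term (fun e => (t e)^-1).
Proof. by move=> [a [m Ha]]; exists (GRing.Inv a), m => k e /= /Ha->. Qed.

Lemma defn_ext P Q : (forall e, P e <-> Q e) -> defn_pred P -> defn_pred Q.
Proof. by move=> PQ [f [B H]]; exists f, B => n e Hn; rewrite -PQ; exact: H. Qed.

Lemma defn_eq t1 t2 : defn_term t1 -> defn_term t2 -> defn_pred (fun e => t1 e = t2 e).
Proof.
move=> [a [m Ha]] [b [n Hb]]; exists (Equal N a b), (maxn m n) => k e.
by rewrite geq_max /= => /andP[/Ha-> /Hb->].
Qed.

Lemma defn_lt t1 t2 : defn_term t1 -> defn_term t2 -> defn_pred (fun e => t1 e < t2 e).
Proof.
move=> [a [m Ha]] [b [n Hb]]; exists (Less N a b), (maxn m n) => k e.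
by rewrite geq_max /= => /andP[/Ha-> /Hb->].
Qed.

Lemma defn_not P : defn_pred P -> defn_pred (fun e => ~ P e).
Proof. by move=> [f [B H]]; exists (Not f), B => n e Hn /=; rewrite (H n e Hn). Qed.

Lemma defn_and P Q : defn_pred P -> defn_pred Q -> defn_pred (fun e => P e /\ Q e).
Proof.
move=> [f [m Hf]] [g [n Hg]]; exists (And f g), (maxn m n) => k e.
by rewrite geq_max /= => /andP[/Hf-> /Hg->].
Qed.

Lemma defn_or P Q : defn_pred P -> defn_pred Q -> defn_pred (fun e => P e \/ Q e).
Proof.
move=> HP HQ.
apply: (@defn_ext (fun e => ~ (~ P e /\ ~ Q e))); last first.
  by apply: defn_not; apply: defn_and; apply: defn_not.
by move=> e; rewrite -not_orE; split=> [/contrapT|//] H.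
Qed.

Lemma defn_imp P Q : defn_pred P -> defn_pred Q -> defn_pred (fun e => P e -> Q e).
Proof.
move=> HP HQ; apply: (@defn_ext (fun e => ~ P e \/ Q e)); last first.
  by apply: defn_or => //; exact: defn_not.
by move=> e; rewrite implyE.
Qed.

Lemma defn_iff P Q : defn_pred P -> defn_pred Q -> defn_pred (fun e => P e <-> Q e).
Proof. by move=> HP HQ; apply: defn_and; apply: defn_imp. Qed.

Lemma defn_true : defn_pred (fun=> True).
Proof. by apply: (@defn_ext (fun=> 0 = 0 :> R)) => //;
  apply: defn_eq; apply: defn_term_cst. Qed.

Lemma defn_cst (p : Prop) : defn_pred (fun=> p).
Proof.
have [Hp|Hp] := pselect p.
  by apply: defn_ext defn_true.
by apply: defn_ext (defn_not defn_true).
Qed.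

Lemma defn_le t1 t2 : defn_term t1 -> defn_term t2 -> defn_pred (fun e => t1 e <= t2 e).
Proof.
move=> H1 H2; apply: (@defn_ext (fun e => ~ t2 e < t1 e)).
  by move=> e; rewrite leNgt; split=> /negP.
by apply: defn_not; exact: defn_lt.
Qed.

Lemma defn_dep P : defn_pred P -> exists B, forall e e',
  (forall i, (i < B)%N -> e i = e' i) -> P e <-> P e'.
Proof.
move=> [f [B H]]; exists B => e e' ee'.
rewrite -(H B e) // -(H B e') //; suff -> : mkseq e B = mkseq e' B by [].
by apply/eq_in_map => i; rewrite mem_iota add0n => /ee'.
Qed.

Lemma defn_subst P (s : (nat -> R) -> nat -> R) :
  defn_pred P -> (forall i, defn_term (fun e => s e i)) -> defn_pred (fun e => P (s e)).
Proof.
move=> HP Hs; have [f [B Hf]] := HP.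
have /choice[tt /choice[C Htt]] := Hs.
have [f' Hf'] := subst_formula f tt.
pose m := maxn B (var_bound f).
exists f', (\max_(i < m) C i) => n e Hn.
rewrite Hf' -(Hf m (s e)) ?leq_maxl //; apply: holds_eq_env => i Hi.
have im : (i < m)%N by rewrite leq_max Hi orbT.
rewrite !nth_mkseq //; apply: Htt; apply: leq_trans Hn.
exact: (leq_bigmax (F := fun i : 'I_m => C i) (Ordinal im)).
Qed.

Lemma defn_term_subst t (s : (nat -> R) -> nat -> R) :
  defn_term t -> (forall i, defn_term (fun e => s e i)) -> defn_term (fun e => t (s e)).
Proof.
move=> [a [B Ha]] Hs; have /choice[tt /choice[C Htt]] := Hs.
pose m := maxn B (GRing.ub_var a).
exists (subst_term tt a), (\max_(i < m) C i) => n e Hn.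
rewrite (eval_subst_term _ _ (n := m)) ?leq_maxr // -(Ha m) ?leq_maxl //.
congr (GRing.eval _ a); apply/eq_in_map => i; rewrite mem_iota /= add0n => im.
apply: Htt; apply: leq_trans Hn.
exact: (leq_bigmax (F := fun i : 'I_m => C i) (Ordinal im)).
Qed.

(** Since the quantifier of formulas overwrites a variable instead of shifting
    the others, the quantified variable is first moved to an index [B] beyond
    all variables on which the predicate depends. *)
Lemma defn_ex (Q : R -> (nat -> R) -> Prop) :
  defn_pred (fun e => Q (e 0%N) (fun i => e i.+1)) ->
  defn_pred (fun e => exists x, Q x e).
Proof.
move=> HQ; have [B HB] := defn_dep HQ.
have [|f [C Hf]] := defn_subst (s := fun e => env_cons (e B) e) HQ.
  by case=> [|i] /=; exact: defn_term_var.
exists (Exists B f), (maxn C B.+1) => n e; rewrite geq_max => /andP[Cn Bn] /=.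
suff H x : holds (set_nth 0 (mkseq e n) B x) f <-> Q x e.
  by split=> -[x Hx]; exists x; apply/H.
have -> : set_nth 0 (mkseq e n) B x = mkseq (fun i => if i == B then x else e i) n.
  apply: (@eq_from_nth _ 0); rewrite ?size_set_nth !size_mkseq.
    by apply/maxn_idPr.
  rewrite (maxn_idPr Bn) => i Hi.
  by rewrite nth_set_nth /= !nth_mkseq.
rewrite Hf //= eqxx.
apply: (HB (env_cons x (fun i => if i == B then x else e i)) (env_cons x e)) => -[|i] //= Hi.
by rewrite ltn_eqF // ltnW.
Qed.

Lemma defn_all (Q : R -> (nat -> R) -> Prop) :
  defn_pred (fun e => Q (e 0%N) (fun i => e i.+1)) ->
  defn_pred (fun e => forall x, Q x e).
Proof.
move=> HQ; apply: (@defn_ext (fun e => ~ exists x, ~ Q x e)).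
  by move=> e; rewrite -forallNE; split=> H x; [apply: contrapT; exact: H|apply].
by apply/defn_not/defn_ex/defn_not.
Qed.

Definition defn_family (P : R -> (nat -> R) -> Prop) : Prop :=
  defn_pred (fun e => P (e 0%N) (fun i => e i.+1)).

Lemma defn_app P t (s : (nat -> R) -> nat -> R) : defn_family P -> defn_term t ->
  (forall i, defn_term (fun e => s e i)) -> defn_pred (fun e => P (t e) (s e)).
Proof.
move=> HP Ht Hs; apply: (defn_subst (s := fun e => env_cons (t e) (s e)) HP).
by case.
Qed.

Lemma definable_defn n (A : set 'rV[R]_n) (ts : 'I_n -> (nat -> R) -> R) :
  definable N A -> (forall i, defn_term (ts i)) -> defn_pred (fun e => A (\row_i ts i e)).
Proof.
move=> [f ->] Hts.
pose s e i := if insub i is Some j then ts j e else 0.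
have Hs i : defn_term (fun e => s e i).
  by rewrite /s; case: insub => [j|]; [exact: Hts|exact: defn_term_cst].
apply: (@defn_ext (fun e => holds (mkseq (s e) (var_bound f)) f)).
  move=> e /=; apply: holds_eq_env => i Hi; rewrite nth_mkseq //.
  rewrite /s; case: insubP => [j _ <-|].
    rewrite (nth_map j); last by rewrite size_enum_ord; exact: ltn_ord.
    rewrite mxE; congr (ts _ e).
    by apply: val_inj; rewrite /= nth_enum_ord //; exact: ltn_ord.
  by rewrite -leqNgt => Hn; rewrite nth_default // size_map size_enum_ord.
apply: (@defn_subst (fun e => holds (mkseq e (var_bound f)) f)) => //.
exists f, (var_bound f) => m e Hm; apply: holds_eq_env => i Hi.
by rewrite !nth_mkseq // (leq_trans Hi).
Qed.

Lemma defn_definable n (A : set 'rV[R]_n) P : defn_pred P ->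
  (forall (v : 'rV[R]_n) (e : nat -> R), (forall i : 'I_n, e i = v ord0 i) ->
    A v <-> P e) ->
  definable N A.
Proof.
move=> [f [B Hf]] HA; exists f; apply/seteqP; split=> v /=;
  set s := [seq v ord0 i | i <- enum 'I_n];
  have He (i : 'I_n) : nth 0 s i = v ord0 i
    by rewrite (nth_map i) ?size_enum_ord // nth_ord_enum.
  move=> Av; apply/(@holds_eq_env _ _ _ _ (mkseq (nth 0 s) (maxn B (var_bound f)))).
    by move=> i Hi; rewrite nth_mkseq // leq_max Hi orbT.
  by apply/Hf; rewrite ?leq_maxl //; apply/(HA v (nth 0 s) He).
move=> Hv; apply/(HA v (nth 0 s) He).
apply/(Hf (maxn B (var_bound f))); first by rewrite leq_maxl.
apply/(@holds_eq_env _ _ f (mkseq (nth 0 s) (maxn B (var_bound f))) s) => [i Hi|//].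
by rewrite nth_mkseq // leq_max Hi orbT.
Qed.

End Calculus.

Section Expansion.
Variables (R : realType) (N N' : expansion R).
Hypothesis sub : forall n (S : set 'rV[R]_n), N S -> N' S.

Lemma defn_expand P : defn_pred N P -> defn_pred N' P.
Proof.
move=> [f [B Hf]].
suff [f' Hf'] : exists f' : formula N', forall e, holds e f' <-> holds e f.
  by exists f', B => n e Hn; rewrite Hf'; exact: Hf.
elim: f {P B Hf} => [t1 t2|t1 t2|n S E ts|g [g' Hg]|g [g' Hg] h [h' Hh]|k g [g' Hg]].
- by exists (Equal N' t1 t2).
- by exists (Less N' t1 t2).
- by exists (Rel (sub E) ts).
- by exists (Not g') => e /=; rewrite Hg.
- by exists (And g' h') => e /=; rewrite Hg Hh.
- by exists (Exists k g') => e /=; split=> -[x Hx]; exists x; apply/Hg.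
Qed.

End Expansion.

Lemma definable_prim (R : realType) (N : expansion R) n (S : set 'rV[R]_n) :
  N n S -> definable N S.
Proof.
move=> E; exists (Rel E (fun i => GRing.Var _ i)).
have row (v : 'rV[R]_n) : \row_i [seq v ord0 j | j <- enum 'I_n]`_i = v.
  by apply/rowP => i; rewrite mxE (nth_map i) ?size_enum_ord // nth_ord_enum.
by apply/seteqP; split=> v /=; rewrite row.
Qed.

(** * Locally constant sets of reals *)

Section LocallyConstant.
Variable R : realType.
Implicit Types (S : R -> Prop) (a b x z : R).

Definition loc_const S x : Prop :=
  exists d, 0 < d /\ forall z, x - d < z /\ z < x + d -> (S z <-> S x).

Definition finitely_many S : Prop := exists s : seq R, forall x, S x -> x \in s.

(** The one-variable content of o-minimality: finite unions of intervals are
    locally constant at all but finitely many points, and this property is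
    stable under Boolean operations. *)
Definition tame S : Prop := finitely_many (fun x => ~ loc_const S x).

Lemma fin_sub S S' : (forall x, S x -> S' x) -> finitely_many S' -> finitely_many S.
Proof. by move=> SS' [s Hs]; exists s => x /SS'/Hs. Qed.

Lemma finU S S' : finitely_many S -> finitely_many S' ->
  finitely_many (fun x => S x \/ S' x).
Proof.
move=> [s Hs] [s' Hs']; exists (s ++ s') => x.
by rewrite mem_cat => -[/Hs->|/Hs'->]; rewrite ?orbT.
Qed.

Lemma fin_bigU S (F : R -> R -> Prop) : finitely_many S ->
  (forall x, S x -> finitely_many (F x)) ->
  finitely_many (fun y => exists x, S x /\ F x y).
Proof.
move=> [s]; elim: s S => [|a s IH] S Hs HF.
  by exists [::] => y [x [/Hs]].
have [//||t Ht] := IH (fun x => S x /\ x <> a).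
- by move=> x [/Hs]; rewrite inE => /orP[/eqP|].
- by move=> x [Sx _]; exact: HF.
have [Sa|nSa] := pselect (S a).
- have [t' Ht'] := HF _ Sa; exists (t' ++ t) => y [x [Sx Fxy]]; rewrite mem_cat.
  have [xa|xa] := pselect (x = a); first by rewrite Ht' // -xa.
  by rewrite (Ht y) ?orbT //; exists x.
- exists t => y [x [Sx Fxy]]; apply: Ht; exists x; split=> //; split=> // xa.
  by apply: nSa; rewrite -xa.
Qed.

Lemma fin_seq S : finitely_many S -> exists s : seq R, uniq s /\ forall x, S x <-> x \in s.
Proof.
move=> [s Hs]; exists (undup [seq x <- s | `[< S x >]]); split; first exact: undup_uniq.
move=> x; rewrite mem_undup mem_filter; split=> [Sx|/andP[/asboolP//]].
by rewrite Hs // andbT; apply/asboolP.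
Qed.

Lemma loc_const_ext S S' x : (forall z, S z <-> S' z) -> loc_const S x ->
  loc_const S' x.
Proof.
by move=> SS' [d [d0 H]]; exists d; split=> // z Hz; rewrite -!SS'; exact: H.
Qed.

Lemma loc_const_opp S x : loc_const S x -> loc_const (fun z => ~ S z) x.
Proof. by move=> [d [d0 H]]; exists d; split=> // z /H ->. Qed.

Lemma loc_constI S S' x : loc_const S x -> loc_const S' x ->
  loc_const (fun z => S z /\ S' z) x.
Proof.
move=> [d [d0 H]] [d' [d'0 H']].
have [dd|dd] := leP d d'; [exists d | exists d']; split=> // z Hz;
  (have -> : S z <-> S x by apply: H; lra);
  by have -> : S' z <-> S' x by apply: H'; lra.
Qed.

Lemma loc_constU S S' x : loc_const S x -> loc_const S' x ->
  loc_const (fun z => S z \/ S' z) x.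
Proof.
move=> H H'.
apply: (loc_const_ext (S := fun z => ~ (~ S z /\ ~ S' z))).
  by move=> z; rewrite -not_orE; split=> [/contrapT|//] ?.
by apply/loc_const_opp/loc_constI; apply: loc_const_opp.
Qed.

Lemma loc_const_lt x c : x != c -> loc_const (fun z => z < c) x.
Proof.
rewrite neq_lt => /orP[xc|cx]; [exists (c - x)|exists (x - c)];
  (split; first by rewrite subr_gt0); move=> z Hz; by split=> ?; lra.
Qed.

Lemma loc_const_le x c : x != c -> loc_const (fun z => z <= c) x.
Proof.
rewrite neq_lt => /orP[xc|cx]; [exists (c - x)|exists (x - c)];
  (split; first by rewrite subr_gt0); move=> z Hz; by split=> ?; lra.
Qed.

Lemma loc_const_cst (p : Prop) x : loc_const (fun=> p) x.
Proof. by exists 1. Qed.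

Lemma tame_ext S S' : (forall z, S z <-> S' z) -> tame S -> tame S'.
Proof.
move=> SS'; apply: fin_sub => x H HS; apply: H.
exact: (loc_const_ext SS').
Qed.

Lemma tameI S S' : tame S -> tame S' -> tame (fun z => S z /\ S' z).
Proof.
move=> H H'; apply: fin_sub (finU H H') => x.
move=> HSS'; apply/not_andP => -[? ?]; apply: HSS'; exact: loc_constI.
Qed.

Lemma tameU S S' : tame S -> tame S' -> tame (fun z => S z \/ S' z).
Proof.
move=> H H'; apply: fin_sub (finU H H') => x.
move=> HSS'; apply/not_andP => -[? ?]; apply: HSS'; exact: loc_constU.
Qed.

Lemma tame_opp S : tame S -> tame (fun z => ~ S z).
Proof. by apply: fin_sub => x H HS; apply: H; exact: loc_const_opp. Qed.

Lemma tame_lt c : tame (fun z => z < c).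
Proof.
exists [:: c] => x H; rewrite inE; apply/negP => /negP xc; apply: H.
exact: loc_const_lt.
Qed.

Lemma tame_le c : tame (fun z => z <= c).
Proof.
exists [:: c] => x H; rewrite inE; apply/negP => /negP xc; apply: H.
exact: loc_const_le.
Qed.

Lemma tame_cst (p : Prop) : tame (fun=> p).
Proof. by exists [::] => x []; exact: loc_const_cst. Qed.

Lemma tame_itv (I : interval R) : tame (fun z => z \in I).
Proof.
case: I => a b.
have Ha : tame (fun z => (a <= BLeft z)%O : Prop).
  case: a => [[] c|[]].
  - apply: tame_ext (tame_opp (tame_lt c)) => z.
    by rewrite bnd_simp leNgt; split=> /negP.
  - apply: tame_ext (tame_opp (tame_le c)) => z.
    by rewrite bnd_simp ltNge; split=> /negP.
  - by apply: tame_ext (tame_cst True) => z.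
  - by apply: tame_ext (tame_cst False) => z.
have Hb : tame (fun z => (BRight z <= b)%O : Prop).
  case: b => [[] c|[]].
  - by apply: tame_ext (tame_lt c) => z; rewrite bnd_simp.
  - by apply: tame_ext (tame_le c) => z; rewrite bnd_simp.
  - by apply: tame_ext (tame_cst False) => z.
  - by apply: tame_ext (tame_cst True) => z.
by apply: tame_ext (tameI Ha Hb) => z; rewrite itv_boundlr; split=> /andP.
Qed.

Lemma tame_bigU (s : seq (interval R)) :
  tame (\big[setU/set0]_(I <- s) [set` I]).
Proof.
elim: s => [|I s IH]; first by rewrite big_nil; exact: (tame_cst False).
rewrite big_cons; exact: (tameU (tame_itv I) IH).
Qed.

(** The supremum of the points up to which [S] keeps its value at [a] is [b]. *)
Lemma loc_const_segment S a b : a <= b ->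
  (forall x, a <= x -> x <= b -> loc_const S x) -> (S a <-> S b).
Proof.
move=> ab Hl.
pose E := [set c | [/\ a <= c, c <= b & forall z, a <= z -> z <= c -> (S z <-> S a)]].
have Ea : E a.
  by split=> // z az za; have -> : z = a by apply/eqP; rewrite eq_le za.
have hE : has_sup E by split; [exists a | exists b => c []].
pose m := sup E.
have am : a <= m by exact: sup_upper_bound.
have mb : m <= b by apply: ge_sup; [exists a | move=> c []].
have [d [d0 Hd]] := Hl m am mb.
have [c [ac cb Hc] mc] := sup_adherent d0 hE.
have cm : c <= m by exact: sup_upper_bound.
have Sm : S m <-> S a.
  rewrite -(Hc c) //; rewrite (Hd c) //; rewrite -/m in mc; lra.
have Em : E (Num.min b (m + d / 2)).
  split; [by rewrite le_min ab /=; lra|by rewrite ge_min lexx|].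
  move=> z az; rewrite le_min => /andP[zb zm].
  have [zc|zc] := leP z c; first exact: Hc.
  by rewrite Hd //; rewrite -/m in mc; lra.
have bm : b <= m.
  have := sup_upper_bound hE Em; rewrite -/m ge_min => /orP[//|]; lra.
by rewrite -Sm; have -> : m = b by apply/eqP; rewrite eq_le mb.
Qed.

Lemma countable_avoid (C : set R) a b : countable C -> a < b ->
  exists x, [/\ a < x, x < b & ~ C x].
Proof.
move=> cC ab; apply: contrapT => H.
have sub : [set` `]a, b[] `<=` C.
  move=> x /=; rewrite in_itv /= => /andP[ax xb]; apply: contrapT => Cx.
  by apply: H; exists x.
have := countable_lebesgue_measure0 (sub_countable (subset_card_le sub) cC).
rewrite lebesgue_measure_itv /= lte_fin ab -EFinD => -[] /eqP.
by rewrite subr_eq0 gt_eqF.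
Qed.

Lemma seq_pred (s : seq R) x : (forall b, b \in s -> x <= b) \/
  exists b, [/\ b \in s, b < x & forall b', b' \in s -> b' < x -> b' <= b].
Proof.
elim: s => [|c s [IH|[b [bs bx Hb]]]]; first by left.
- have [xc|cx] := leP x c.
    by left=> b; rewrite inE => /orP[/eqP->//|/IH].
  right; exists c; split=> //; first by rewrite mem_head.
  by move=> b'; rewrite inE => /orP[/eqP->//|/IH xb' /lt_geF]; rewrite xb'.
- have [xc|cx] := leP x c.
    right; exists b; split=> //; first by rewrite inE bs orbT.
    move=> b'; rewrite inE => /orP[/eqP-> /lt_geF|/Hb//]; by rewrite xc.
  right; have [cb|bc] := leP c b.
    exists b; split=> //; first by rewrite inE bs orbT.
    by move=> b'; rewrite inE => /orP[/eqP->|/Hb].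
  exists c; split=> //; first by rewrite mem_head.
  move=> b'; rewrite inE => /orP[/eqP->//|/Hb Hb' /Hb' b'b].
  exact: (le_trans b'b (ltW bc)).
Qed.

Lemma seq_succ (s : seq R) x : (forall b, b \in s -> b <= x) \/
  exists b, [/\ b \in s, x < b & forall b', b' \in s -> x < b' -> b <= b'].
Proof.
have [H|[b [bs bx Hb]]] := seq_pred (map -%R s) (- x).
  by left=> b bs; rewrite -lerN2; apply: H; rewrite map_f.
move/mapP: bs => [c cs bc]; right; exists c; split=> //.
  by rewrite -ltrN2 -bc.
move=> b' b's xb'; rewrite -lerN2 -bc; apply: Hb; last by rewrite ltrN2.
by rewrite map_f.
Qed.

Lemma seq_pos_lb (s : seq R) : (forall x, x \in s -> 0 < x) ->
  exists e, 0 < e /\ forall x, x \in s -> e <= x.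
Proof.
elim: s => [|c s IH] Hs; first by exists 1; split.
have [|e [e0 He]] := IH; first by move=> x xs; apply: Hs; rewrite inE xs orbT.
exists (Num.min c e); split; first by rewrite lt_min e0 Hs ?mem_head.
move=> x; rewrite inE => /orP[/eqP->|/He ex]; first by rewrite ge_min lexx.
by rewrite ge_min ex orbT.
Qed.

(** Finitely many points, among them those of [B], that meet every component of
    the complement of a finite set [B].  They need no ordering of [B]: a bounded
    component contains the midpoint of its endpoints, a half-line contains its
    endpoint shifted by one, and [0] serves the case that [B] is empty. *)
Definition sample (B : R -> Prop) (x : R) : Prop :=
  x = 0 \/ exists b, B b /\ exists b', B b' /\
    (x = (b + b') / 2 \/ x = b + 1 \/ x = b - 1).

Lemma fin_sample B : finitely_many B -> finitely_many (sample B).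
Proof.
move=> HB; apply: finU; first by exists [:: 0] => x ->; rewrite mem_head.
apply: (fin_bigU (F := fun b x => exists b', B b' /\ _)) => // b _.
apply: (fin_bigU (F := fun b' x => _)) => // b' _.
by exists [:: (b + b') / 2; b + 1; b - 1] => x [->|[->|->]]; rewrite !inE eqxx ?orbT.
Qed.

Lemma sample_component B x : finitely_many B -> ~ B x -> exists x0, sample B x0 /\
  forall z, (x0 <= z /\ z <= x) \/ (x <= z /\ z <= x0) -> ~ B z.
Proof.
move=> /fin_seq[s [_ Bs]] Bx.
have xB z : B z -> z != x by move=> Bz; apply/negP => /eqP zx; rewrite zx in Bz.
have [Hl|[b [bs bx Hb]]] := seq_pred s x; have [Hr|[c [cs xc Hc]]] := seq_succ s x.
- exists 0; split; first by left.
  move=> z _ Bz; have zx := xB _ Bz; move/Bs in Bz.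
  by move: zx; rewrite eq_le (Hl _ Bz) (Hr _ Bz).
- exists (c - 1); split.
    by right; exists c; split; [exact/Bs|exists c; split; [exact/Bs|auto]].
  move=> z Hz Bz; have zx := xB _ Bz; move/Bs in Bz.
  have xz : x < z by rewrite lt_neqAle eq_sym zx Hl.
  have := Hc _ Bz xz; lra.
- exists (b + 1); split.
    by right; exists b; split; [exact/Bs|exists b; split; [exact/Bs|auto]].
  move=> z Hz Bz; have zx := xB _ Bz; move/Bs in Bz.
  have xz : z < x by rewrite lt_neqAle zx Hr.
  have := Hb _ Bz xz; lra.
- exists ((b + c) / 2); split.
    by right; exists b; split; [exact/Bs|exists c; split; [exact/Bs|auto]].
  move=> z Hz Bz; have := xB _ Bz; move/Bs in Bz.
  rewrite neq_lt => /orP[zx|xz]; first by have := Hb _ Bz zx; lra.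
  by have := Hc _ Bz xz; lra.
Qed.

End LocallyConstant.

(** * Families of finite sets with one real parameter *)

Section Variation.
Variable R : realType.
Implicit Types (A B : R -> Prop) (S : R -> R -> Prop) (x y z : R).

Definition at_most (K : nat) A : Prop :=
  forall s : seq R, uniq s -> (forall y, y \in s -> A y) -> (size s <= K)%N.

Definition eps_close (eps : R) y z : Prop := y - eps < z /\ z < y + eps.

Definition exactly_one A : Prop := exists z, A z /\ forall z', A z' -> z' = z.

(** A first-order substitute for having the same number of elements: being
    bijectively related by closeness up to some [eps]. *)
Definition matched A B : Prop := exists eps,
  (forall y, A y -> exactly_one (fun z => B z /\ eps_close eps y z)) /\
  (forall z, B z -> exactly_one (fun y => A y /\ eps_close eps y z)).

Definition stable S x : Prop :=
  exists d, 0 < d /\ forall x', x - d < x' /\ x' < x + d -> matched (S x) (S x').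

Lemma at_most_inj K A B (r : R -> R -> Prop) :
  (forall y, A y -> exists z, B z /\ r y z) ->
  (forall y y' z, A y -> A y' -> r y z -> r y' z -> y = y') ->
  at_most K B -> at_most K A.
Proof.
move=> HAB Hinj HB s us sA.
have /choice[f Hf] : forall y, exists z, A y -> B z /\ r y z.
  move=> y; have [/HAB[z Hz]|nA] := pselect (A y); first by exists z.
  by exists 0 => /nA.
rewrite -(size_map f); apply: HB.
  rewrite map_inj_in_uniq // => y y' /sA Ay /sA Ay' ff.
  by apply: (Hinj _ _ (f y)) => //; [exact: (Hf y Ay).2|rewrite ff; exact: (Hf y' Ay').2].
by move=> z /mapP[y /sA /Hf[Bz _] ->].
Qed.

Lemma matched_at_most K A B : matched A B -> (at_most K A <-> at_most K B).
Proof.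
move=> [eps [HA HB]]; split.
- apply: (at_most_inj (r := fun z y => A y /\ eps_close eps y z)).
    by move=> z Bz; have [y [[Ay yz] _]] := HB z Bz; exists y.
  move=> z z' y Bz Bz' [Ay yz] [_ yz'].
  have [w [_ Hw]] := HA y Ay.
  by rewrite (Hw z) // (Hw z').
- apply: (at_most_inj (r := fun y z => B z /\ eps_close eps y z)).
    by move=> y /HA[z [[Bz yz] _]]; exists z.
  move=> y y' z Ay Ay' [Bz yz] [_ yz'].
  have [w [_ Hw]] := HB z Bz.
  by rewrite (Hw y) // (Hw y').
Qed.

(** Rational endpoints leave only countably many conditions of this kind, and
    each finite set satisfies one of them with arbitrarily short intervals. *)
Definition isolated_by A (l : seq (rat * rat)) : Prop :=
  (forall z, A z -> exists2 I, I \in l & ratr I.1 < z /\ z < ratr I.2) /\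
  (forall I, I \in l -> exactly_one (fun z => A z /\ (ratr I.1 < z /\ z < ratr I.2))).

Lemma fin_separated A : finitely_many A -> exists eps, 0 < eps /\
  forall y y' z, A y -> A y' -> eps_close eps y z -> eps_close eps y' z -> y = y'.
Proof.
move=> /fin_seq[s [_ As]].
have [|e [e0 He]] := @seq_pos_lb _ [seq x <- [seq y' - y | y <- s, y' <- s] | 0 < x].
  by move=> x; rewrite mem_filter => /andP[].
exists (e / 2); split; first by rewrite divr_gt0.
have H y y' : A y -> A y' -> y < y' -> e <= y' - y.
  move=> /As ys /As y's yy'; apply: He.
  by rewrite mem_filter subr_gt0 yy' /=; apply/allpairsP; exists (y, y').
move=> y y' z Ay Ay' [? ?] [? ?]; have [yy'|y'y|//] := ltgtP y y'.
- by have := H _ _ Ay Ay' yy'; lra.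
- by have := H _ _ Ay' Ay y'y; lra.
Qed.

(** For each list [l] of rational intervals, the parameters at which [l] isolates
    the points of the fibre form a set with finitely many jumps.  At a parameter
    outside these countably many jumps, a list of short intervals that isolates
    the points of the fibre still does so for the nearby fibres. *)
Lemma stable_cocountable S : (forall x, finitely_many (S x)) ->
  (forall l, tame (fun x => isolated_by (S x) l)) ->
  exists C : set R, countable C /\ forall x, ~ C x -> stable S x.
Proof.
move=> fS tS; have /choice[J HJ] := tS.
exists (\bigcup_(l in [set: seq (rat * rat)]) [set` J l]); split.
  apply: bigcup_countable => // l _; exact: finite_set_countable (finite_seq _).
move=> x Cx.
have [eps [e0 He]] := fin_separated (fS x).
have /choice[q Hq] : forall y, exists I : rat * rat,
    [/\ y - eps < ratr I.1, ratr I.1 < y, y < ratr I.2 & ratr I.2 < y + eps].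
  move=> y.
  have [|a] := @rat_in_itvoo R (y - eps) y; first by lra.
  have [|b] := @rat_in_itvoo R y (y + eps); first by lra.
  by rewrite !in_itv /= => /andP[? ?] /andP[? ?]; exists (a, b).
have near_q y z : ratr (q y).1 < z /\ z < ratr (q y).2 -> eps_close eps y z.
  by have [? ? ? ?] := Hq y; rewrite /eps_close; lra.
have [s [us Ss]] := fin_seq (fS x).
have near_self y : eps_close eps y y by rewrite /eps_close; lra.
have in_q y : ratr (q y).1 < y /\ y < ratr (q y).2 by have [? ? ? ?] := Hq y.
pose l := map q s.
have Gx : isolated_by (S x) l.
  split=> [z Sz|I /mapP[y /Ss Sy ->]].
    by exists (q z) => //; apply: map_f; apply/Ss.
  exists y; split=> // z [Sz /near_q yz].
  exact/esym/(He y z z).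
have [d [d0 Hd]] : loc_const (fun x => isolated_by (S x) l) x.
  apply: contrapT => /HJ xJ; apply: Cx; by exists l.
exists d; split=> // x' /Hd [_ /(_ Gx)] [G1 G2].
have {}Gx := Gx.2.
exists eps; split=> [y Sy|z Sz].
  have yl : q y \in l by apply/map_f/Ss.
  have [z [[Sz zy] Hz]] := G2 _ yl.
  exists z; split; first by split=> //; exact: near_q.
  move=> z' [Sz' yz']; have [I /mapP[y' /Ss Sy' ->] Iz'] := G1 _ Sz'.
  have yy' := He _ _ _ Sy Sy' yz' (near_q _ _ Iz'); rewrite -yy' in Iz'.
  exact: Hz.
have [I /mapP[y /Ss Sy ->] Iz] := G1 _ Sz.
exists y; split; first by split=> //; exact: near_q.
move=> y' [Sy' y'z]; exact: (He y' y z Sy' Sy y'z (near_q _ _ Iz)).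
Qed.

End Variation.

(** * Uniform finiteness *)

(** Decomposes a definability goal along the syntax of its predicate or term. *)
Ltac dfn_step := first
  [ exact: defn_term_var | exact: defn_term_cst
  | apply: defn_term_add | apply: defn_term_mul | apply: defn_term_opp
  | apply: defn_term_inv
  | apply: defn_and | apply: defn_or | apply: defn_iff | apply: defn_not
  | apply: defn_lt | apply: defn_le | apply: defn_eq
  | apply: defn_imp
  | apply: defn_ex => /= | apply: defn_all => /= ].
Ltac dfn := repeat dfn_step.

Section UniformFiniteness.
Variables (R : realType) (M : expansion R).
Hypothesis oM : o_minimal M.
Implicit Types (P : R -> (nat -> R) -> Prop) (e : nat -> R).

Lemma definable_fiber P e : defn_family M P ->
  definable M [set v : 'rV[R]_1 | [set x | P x e] (v ord0 ord0)].
Proof.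
move=> HP; apply: (@defn_definable _ _ _ _ (fun e' => P (e' 0%N) e)).
  apply: (defn_app HP); [exact: defn_term_var|move=> i; exact: defn_term_cst].
by move=> v e' /(_ ord0) /= ->.
Qed.

Lemma defn_tame P e : defn_family M P -> tame (fun x => P x e).
Proof.
move=> HP; have [s Hs] := oM (definable_fiber e HP).
by apply: tame_ext (tame_bigU s) => z; rewrite -Hs.
Qed.

Lemma defn_loc_const P : defn_family M P ->
  defn_family M (fun x e => loc_const (fun z => P z e) x).
Proof.
by move=> HP; rewrite /defn_family /loc_const; dfn; apply: (defn_app HP) => [|i];
  exact: defn_term_var.
Qed.

Lemma defn_isolated_by P l : defn_family M P ->
  defn_pred M (fun e => isolated_by (fun y => P y e) l).
Proof.
move=> HP; rewrite /isolated_by /exactly_one.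
have Hex (Q : rat * rat -> (nat -> R) -> Prop) : (forall I, defn_pred M (Q I)) ->
    defn_pred M (fun e => exists2 I, I \in l & Q I e).
  move=> HQ; elim: l => [|I l IH].
    by apply: defn_ext (defn_cst M False) => e; split=> // -[].
  apply: defn_ext (defn_or (HQ I) IH) => e; split=> [[H|[J Jl H]]|[J]].
  - by exists I; rewrite ?mem_head.
  - by exists J; rewrite // inE Jl orbT.
  - by rewrite inE => /orP[/eqP->|Jl]; [left|right; exists J].
have Hall (Q : rat * rat -> (nat -> R) -> Prop) : (forall I, defn_pred M (Q I)) ->
    defn_pred M (fun e => forall I, I \in l -> Q I e).
  move=> HQ; elim: l {Hex} => [|I l IH].
    by apply: defn_ext (defn_true M) => e.
  apply: defn_ext (defn_and (HQ I) IH) => e; split=> [[H H' J]|H].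
  - by rewrite inE => /orP[/eqP->|/H'].
  - by split=> [|J Jl]; apply: H; rewrite inE ?eqxx ?Jl ?orbT.
apply: defn_and.
  dfn; first by apply: (defn_app HP) => [|i]; exact: defn_term_var.
  by apply: Hex => I; dfn.
by apply: Hall => I; dfn; apply: (defn_app HP) => [|i]; exact: defn_term_var.
Qed.

Lemma defn_stable P : defn_family M P ->
  defn_family M (fun x e => stable (fun x y => P y (env_cons x e)) x).
Proof.
move=> HP; rewrite /defn_family /stable /matched /exactly_one /eps_close; dfn;
  by apply: (defn_app HP) => [|[|i]]; exact: defn_term_var.
Qed.

Lemma defn_sample P : defn_family M P ->
  defn_family M (fun x e => sample (fun y => P y e) x).
Proof.
move=> HP; rewrite /defn_family /sample; dfn;
  by apply: (defn_app HP) => [|[|i]]; exact: defn_term_var.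
Qed.

Lemma fin_at_most S : @finitely_many R S -> exists K, at_most K S.
Proof.
move=> [s Hs]; exists (size s) => t ut tS.
by apply: uniq_leq_size => // y /tS/Hs.
Qed.

(** Fix all parameters but the first, [x].  The values of [x] at which the fibres
    do not vary continuously are countably many and form a definable set, so
    they are finitely many, and between them the number of points of the fibre
    is constant.  Hence this number is bounded as soon as it is bounded at the
    finitely many sample values of [x]; the union of the fibres over the sample
    values is a family of finite sets with one parameter fewer. *)
Theorem uniform_finiteness (p : nat) P : defn_family M P ->
  (forall y e e', (forall i, (i < p)%N -> e i = e' i) -> (P y e <-> P y e')) ->
  (forall e, finitely_many (fun y => P y e)) ->
  exists K, forall e, at_most K (fun y => P y e).
Proof.
elim: p P => [|p IH] P HP dep fP.
  have [K HK] := fin_at_most (fP (fun=> 0)).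
  by exists K => e s us Hs; apply: HK => // y /Hs /dep; apply.
pose S e x y := P y (env_cons x e).
pose bad x e := ~ stable (S e) x.
have dbad : defn_family M bad by apply: defn_not; exact: defn_stable.
have fbad e : finitely_many (fun x => bad x e).
  have diso l : defn_family M (fun x e => isolated_by (S e x) l).
    apply: (defn_subst (s := fun e => env_cons (e 0%N) (fun i => e i.+1))
      (defn_isolated_by l HP)).
    by case=> [|i]; exact: defn_term_var.
  have [C [cC HC]] := stable_cocountable (fun x => fP (env_cons x e))
    (fun l => defn_tame e (diso l)).
  (* a bad point that is not a jump of the bad set has a neighbourhood of bad
     points, which is uncountable *)
  apply: fin_sub (defn_tame e dbad) => x bx [d [d0 Hd]].
  have [|z [xz zx Cz]] := @countable_avoid R C (x - d) (x + d) cC; first lra.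
  by have /Hd[_ /(_ bx)] := conj xz zx; apply; exact: HC.
pose T y e := exists x, sample (fun b => bad b e) x /\ P y (env_cons x e).
have dT : defn_family M T.
  apply: defn_ex => /=; apply: defn_and.
    apply: (defn_app (t := fun e => e 0%N) (s := fun e i => e i.+2)
      (defn_sample dbad)); first exact: defn_term_var.
    by move=> i; exact: defn_term_var.
  by apply: (defn_app HP) => [|[|i]]; exact: defn_term_var.
have depS e e' x y : (forall i, (i < p)%N -> e i = e' i) -> S e x y <-> S e' x y.
  by move=> ee'; apply: dep => -[|i] //= ip; exact: ee'.
have [||K HK] := IH T dT.
- move=> y e e' ee'.
  have SS : S e = S e'.
    by apply/funext => x; apply/funext => z; apply/propext; exact: depS.
  rewrite /T /bad SS; split=> -[x [sx /(depS _ _ _ _ ee') Px]]; exists x => //.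
- by move=> e; apply: fin_bigU => [|x _]; [exact: fin_sample|exact: fP].
exists K => e.
have -> : e = env_cons (e 0%N) (fun i => e i.+1) by apply/funext => -[].
move: (e 0%N) (fun i => e i.+1) => x {}e.
have Hs x0 : sample (fun b => bad b e) x0 -> at_most K (S e x0).
  by move=> sx0 s us Hs; apply: (HK e) => // y /Hs Py; exists x0.
have [bx|gx] := pselect (bad x e).
  apply: Hs; right; exists x; split=> //; exists x; split=> //; left; lra.
have [x0 [sx0 Hx0]] := sample_component (fbad e) gx.
have Hl z : ~ bad z e -> loc_const (fun z => at_most K (S e z)) z.
  move=> /contrapT[d [d0 Hd]]; exists d; split=> // z' /Hd.
  by move=> /matched_at_most ->.
have [xx0|x0x] := leP x x0.
  rewrite (loc_const_segment xx0 (S := fun z => at_most K (S e z))); first exact: Hs.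
  by move=> z xz zx; apply/Hl/Hx0; right.
rewrite -(loc_const_segment (ltW x0x) (S := fun z => at_most K (S e z))).
  exact: Hs.
by move=> z xz zx; apply/Hl/Hx0; left.
Qed.

End UniformFiniteness.

(** * Differentials *)

Section Differentials.
Variables (R : realType) (V : normedModType R).

(** Stated pointwise and with the value of the differential on vectors, so that
    differentials can be computed by composing lemmas. *)
Definition has_diff (W : normedModType R) (f : V -> W) (x : V) (l : V -> W) : Prop :=
  differentiable f x /\ forall v, 'd f x v = l v.

Lemma has_diff_ext (W : normedModType R) (f : V -> W) x l l' :
  has_diff f x l -> (forall v, l v = l' v) -> has_diff f x l'.
Proof. by move=> [D E] ll'; split=> // v; rewrite E ll'. Qed.

Lemma has_diff_cst (W : normedModType R) (w : W) x : has_diff (fun=> w) x (fun=> 0).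
Proof.
split=> [|v]; first exact: differentiable_cst.
by rewrite -/(cst w) diff_cst.
Qed.

Lemma has_diffD (W : normedModType R) (f g : V -> W) x l l' :
  has_diff f x l -> has_diff g x l' ->
  has_diff (fun z => f z + g z) x (fun v => l v + l' v).
Proof.
move=> [D E] [D' E']; split=> [|v]; first exact: differentiableD.
by rewrite -E -E'; move/(congr1 (fun h => h v)): (diffD D D').
Qed.

Lemma has_diffN (W : normedModType R) (f : V -> W) x l :
  has_diff f x l -> has_diff (fun z => - f z) x (fun v => - l v).
Proof.
move=> [D E]; split=> [|v]; first exact: differentiableN.
by rewrite -E; move/(congr1 (fun h => h v)): (diffN D).
Qed.

Lemma has_diffM (f g : V -> R) x l l' :
  has_diff f x l -> has_diff g x l' ->
  has_diff (fun z => f z * g z) x (fun v => f x * l' v + g x * l v).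
Proof.
move=> [D E] [D' E']; split=> [|v]; first exact: differentiableM.
by rewrite -E -E'; move/(congr1 (fun h => h v)): (diffM D D').
Qed.

Lemma has_diffZl (W : normedModType R) (f : V -> R) (w : W) x l :
  has_diff f x l -> has_diff (fun z => f z *: w) x (fun v => l v *: w).
Proof.
move=> [D E]; split=> [|v]; first exact: differentiableZl.
by rewrite diffZl // E.
Qed.

Lemma has_diff_comp (W W' : normedModType R) (f : V -> W) (g : W -> W') x l l' :
  has_diff f x l -> differentiable g (f x) /\ (forall w, 'd g (f x) w = l' w) ->
  has_diff (g \o f) x (fun v => l' (l v)).
Proof.
move=> [D E] [D' E']; split=> [|v]; first exact: differentiable_comp.
by rewrite diff_comp //= E E'.
Qed.

End Differentials.

Section DifferentialsRealVariable.
Variable R : realType.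

Lemma has_diff_is_derive (W : normedModType R) (f : R -> W) (x : R) (df : W) :
  is_derive x 1 f df -> has_diff f x (fun h : R => h *: df).
Proof.
move=> Hf; have dfx : differentiable f x by apply/derivable1_diffP.
split=> // h.
by rewrite diff1E // derive1E (@derive_val _ _ _ _ _ _ _ Hf).
Qed.

Lemma has_diff_derive (V : normedModType R) (f : V -> R) (K : R -> R) x l dK :
  has_diff f x l -> is_derive (f x) 1 K dK ->
  has_diff (fun z => K (f z)) x (fun v => l v * dK).
Proof. by move=> Hf /has_diff_is_derive; apply: has_diff_comp. Qed.

Lemma has_diff_coord (m n : nat) (i : 'I_m) (j : 'I_n) (M : 'M[R]_(m, n)) :
  has_diff (fun P : 'M[R]_(m, n) => P i j : R) M (fun N => N i j).
Proof.
split=> [|N]; first exact: differentiable_coord.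
have @f : {linear 'M[R]_(m, n) -> R}.
  by exists (fun N : 'M[R]_(_, _) => N i j); do 2![eexists]; do ?[constructor];
     rewrite ?mxE// => ? *; rewrite ?mxE//; move=> ?; rewrite !mxE.
rewrite (_ : (fun _ => _) = f) // diff_lin //.
exact: coord_continuous.
Qed.

Lemma has_diff_line (V : normedModType R) (w v : V) (s : R) :
  has_diff (fun t : R => w + t *: v) s (fun h => h *: v).
Proof.
have H := has_diff_is_derive (is_derive_id s 1).
apply: has_diff_ext (has_diffD (has_diff_cst w s) (has_diffZl v H)) _ => h.
by rewrite add0r /GRing.scale /= mulr1.
Qed.

Lemma has_diff_graph_curve (V : normedModType R) (u v : V) (f : R -> R) (x df : R) :
  is_derive x 1 f df ->
  has_diff (fun t : R => t *: u + f t *: v) x (fun h => h *: (u + df *: v)).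
Proof.
move=> /has_diff_is_derive Hf.
have H := has_diff_is_derive (is_derive_id x 1).
apply: has_diff_ext (has_diffD (has_diffZl u H) (has_diffZl v Hf)) _ => h.
by rewrite scalerDr scalerA /GRing.scale /= mulr1.
Qed.

End DifferentialsRealVariable.

(** * First integrals *)

Section FirstIntegral.
Variable R : realType.

Lemma diff0_ball_cst (k : nat) (g : 'rV[R]_k -> R) (w : 'rV[R]_k) (r : R) :
  (forall x : 'rV[R]_k, ball w r x ->
    differentiable g x /\ forall v : 'rV[R]_k, 'd g x v = 0) ->
  forall x : 'rV[R]_k, ball w r x -> g x = g w.
Proof.
move=> Hg x Hx; pose l (s : R) : 'rV[R]_k := w + s *: (x - w).
have dl (s : R) : differentiable l s by have [] := has_diff_line w (x - w) s.
have dlE (s : R) : 'd l s 1 = x - w.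
  by have [_ E] := has_diff_line w (x - w) s; rewrite E scale1r.
have lb (s : R) : 0 <= s -> s <= 1 -> ball w r (l s).
  move=> s0 s1; rewrite -ball_normE /= /l opprD addNKr normrN normrZ ger0_norm //.
  move: Hx; rewrite -ball_normE /= distrC; apply: le_lt_trans.
  by rewrite ler_piMl.
have dgl (s : R) : 0 <= s -> s <= 1 -> is_derive s 1 (g \o l) 0.
  move=> s0 s1; have [dg dg0] := Hg _ (lb _ s0 s1).
  have dc : differentiable (g \o l) s by exact: differentiable_comp.
  apply: DeriveDef; first exact/derivable1_diffP.
  by rewrite deriveE // diff_comp //= dlE dg0.
have [||c _] := @MVT_segment R (g \o l) (fun=> 0) 0 1 ler01.
- by move=> s; rewrite in_itv /= => /andP[? ?]; apply: dgl; apply: ltW.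
- apply: derivable_within_continuous => s; rewrite in_itv /= => /andP[s0 s1].
  by have [] := dgl s s0 s1.
rewrite mul0r /= /l scale1r scale0r addr0 [w + _]addrC subrK => /eqP.
by rewrite subr_eq0 => /eqP.
Qed.

(** In a local parametrization, the differential of [F] vanishes on the tangent
    spaces, which are the kernels of [a], so [F] is locally constant; integral
    manifolds are connected. *)
Lemma first_integral_cst (m : nat) (U : set 'rV[R]_m) (a : 'rV[R]_m -> 'rV[R]_m)
    (F mu : 'rV[R]_m -> R) (Y : topologicalType) (kappa : Y -> 'rV[R]_m) :
  (forall z, has_diff F z (fun v => mu z * form_app a z v)) ->
  integral_manifold U a kappa -> forall y y', F (kappa y) = F (kappa y').
Proof.
move=> HF [[_ Hloc] _ cY _ HT] y0 y1.
have loc y : exists O, [/\ open O, O y & forall y', O y' -> F (kappa y') = F (kappa y)].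
  have [W [phi [Hphi [w Ww <-]]]] := Hloc y.
  have [[oW _] _ phio C1 _] := Hphi.
  have /nbhs_ballP[r r0 rW] : nbhs w W by exact: open_nbhs_nbhs.
  exists (phi @` ball w r); split.
  - exact/phio/rW/ball_open.
  - by exists w => //; exact: ballxx.
  move=> _ [w' Hw' <-].
  apply: (@diff0_ball_cst _ (F \o (kappa \o phi)) w r) => // x Hx.
  have Wx : W x by exact: rW.
  have [dk _] := C1 x Wx; have [dF dFE] := HF (kappa (phi x)).
  split; first exact: differentiable_comp.
  move=> v; rewrite diff_comp //= dFE.
  have : tangent_space m.-1 kappa (phi x) ('d (kappa \o phi) x v).
    by exists W, phi, x; split => //; exists v.
  by rewrite HT /= => ->; rewrite mulr0.
pose B := [set y | F (kappa y) = F (kappa y0)].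
have oB : open B.
  rewrite openE => y /= Hy; have [V [oV Vy HV]] := loc y.
  by apply: filterS (open_nbhs_nbhs (conj oV Vy)) => z Vz; rewrite /B /= HV.
have cB : closed B.
  rewrite -openC openE => y /= Hy; have [V [oV Vy HV]] := loc y.
  by apply: filterS (open_nbhs_nbhs (conj oV Vy)) => z Vz; rewrite /B /= HV.
have BT : B = [set: Y].
  apply: cY; first by exists y0.
  - by exists B => //; rewrite setTI.
  - by exists B => //; rewrite setTI.
by have : B y1 by rewrite BT.
Qed.

End FirstIntegral.

(** * Curves and forms in the plane *)

Section PlaneGraph.
Variable R : realType.

Definition pt (x y : R) : 'rV[R]_2 := x *: delta_mx 0 0 + y *: delta_mx 0 1.

Lemma pt0 x y : pt x y 0 0 = x.
Proof. by rewrite /pt !mxE /= mulr1 mulr0 addr0. Qed.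

Lemma pt1 x y : pt x y 0 1 = y.
Proof. by rewrite /pt !mxE /= mulr0 mulr1 add0r. Qed.

Lemma rV2P (z z' : 'rV[R]_2) : z 0 0 = z' 0 0 -> z 0 1 = z' 0 1 -> z = z'.
Proof.
move=> H0 H1; apply/rowP => -[[|[|//]] Hi].
- by have -> : Ordinal Hi = 0 by exact: val_inj.
- by have -> : Ordinal Hi = 1 by exact: val_inj.
Qed.

Lemma form_app2 (a : 'rV[R]_2 -> 'rV[R]_2) z v :
  form_app a z v = a z 0 0 * v 0 0 + a z 0 1 * v 0 1.
Proof.
rewrite /form_app big_ord_recl big_ord_recl big_ord0 addr0.
by have -> : lift ord0 ord0 = 1 :> 'I_2 by exact: val_inj.
Qed.

(** Stated for filters [G], so as to cover both one-sided limits. *)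
Lemma C1_curve_cvg (m : nat) (gamma gamma' : R -> 'rV[R]_m) (s : R)
    (G : set_system R) : Filter G -> C1_curve gamma gamma' -> s \in `[0, 1] ->
  G `=>` within [set` `[0, 1]] s^' -> G `=>` nbhs s -> gamma @ G --> gamma s.
Proof.
move=> FG [Hg _] /Hg Hs G1 G2.
have H1 : (fun r => (r - s)^-1 *: (gamma r - gamma s)) @ G --> gamma' s.
  by apply: cvg_trans Hs; exact: cvg_app.
have H2 : (fun r : R => r - s) @ G --> (0 : R).
  rewrite -(subrr s); apply: cvgB; [exact: G2|exact: cvg_cst].
have H3 : (fun r => (r - s) *: ((r - s)^-1 *: (gamma r - gamma s)) + gamma s) @ G
    --> gamma s.
  rewrite -[X in _ --> X]add0r -(scale0r (gamma' s)).
  exact: cvgD (cvgZ H2 H1) (cvg_cst (gamma s)).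
have Gn : G [set r | r != s].
  apply: (G1 [set r | r != s]); rewrite /within /=.
  by apply: filterS (nbhs_dnbhs_neq s) => r rs _.
apply: (cvg_trans _ H3); apply: near_eq_cvg.
apply: filterS Gn => r rs.
by rewrite [LHS]/= scalerA mulfV ?subr_eq0 // scale1r subrK.
Qed.

Lemma C1_curve_is_derive (m : nat) (gamma gamma' : R -> 'rV[R]_m) (s : R) :
  C1_curve gamma gamma' -> 0 < s -> s < 1 -> is_derive s 1 gamma (gamma' s).
Proof.
move=> [Hg _] s0 s1.
have {Hg} := Hg s; rewrite in_itv /= !ltW // => /(_ isT) Hs.
have H : h^-1 *: (gamma (h *: 1 + s) - gamma s) @[h --> 0^'] --> gamma' s.
  apply: (cvg_trans _ (cvg_comp (fun h : R => h + s) _ _ Hs)).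
    apply: near_eq_cvg; near=> h => /=.
    by rewrite addrK [h *: _]mulr1.
  move=> A; rewrite /within /= => HA.
  have Hnb : nbhs s (fun r => r != s -> A r).
    have Hin : nbhs s [set` `]0, 1[] by apply: near_in_itvoo; rewrite in_itv /= s0.
    have {}HA : nbhs s (fun r => r != s -> r \in `[0, 1] -> A r) by [].
    apply: filterS2 HA Hin => r HA; rewrite /= in_itv /= => /andP[r0 r1] rs.
    by apply: HA; rewrite // in_itv /= !ltW.
  have cs : (fun h : R => h + s) @ (0 : R) --> s.
    by rewrite -[X in _ --> X]add0r; apply: cvgD; [exact: cvg_id|exact: cvg_cst].
  have H0 : nbhs (0 : R) (fun h => h + s != s -> A (h + s)) := cs _ Hnb.
  have : nbhs (0 : R) (fun h => h != 0 -> A (h + s)).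
    by apply: filterS H0 => h Hh h0; apply: Hh; rewrite -subr_eq0 addrK.
  by [].
apply: DeriveDef; first by apply/cvg_ex; exists (gamma' s).
exact/cvg_lim.
Unshelve. all: by end_near. Qed.

End PlaneGraph.

(** * Graphs that are Rolle leaves *)

Section RolleLeaf.
Variable R : realType.
Local Notation plane := 'rV[R]_2.
Variables (a : plane -> plane) (f f' : R -> R) (F mu : plane -> R) (c : R).
Hypothesis f_derive : forall x : R, is_derive x 1 f (f' x).
Hypothesis f'_cont : continuous f'.
Hypothesis a_dy : forall z, a z 0 1 = 1.
Hypothesis F_diff : forall z : plane,
  has_diff F z (fun v => mu z * form_app a z v).
Hypothesis mu_neq0 : forall z, mu z != 0.
Hypothesis F_graph : forall z, F z = c <-> z 0 1 = f (z 0 0).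

Let iota (x : R) : plane := pt x (f x).
Let phi (w : 'rV[R]_1) : R := w 0 0.
Let dir (x : R) : plane := pt 1 (f' x).

Let F_iota (x : R) : F (iota x) = c.
Proof. by apply/F_graph; rewrite pt0 pt1. Qed.

Let range_iota : range iota = [set z | z 0 1 = f (z 0 0)].
Proof.
apply/seteqP; split=> [_ [x _ <-]|z /= Hz]; first by rewrite /= pt0 pt1.
by exists (z 0 0) => //; apply: rV2P; rewrite ?pt0 ?pt1.
Qed.

Let diff_iota (x : R) : has_diff iota x (fun h => h *: dir x).
Proof.
apply: has_diff_ext (has_diff_graph_curve _ _ (f_derive x)) _ => h.
by rewrite /dir /pt scale1r.
Qed.

Let diff_phi (w : 'rV[R]_1) : has_diff phi w (fun v => v 0 0).
Proof. exact: has_diff_coord. Qed.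

Let diff_param (w : 'rV[R]_1) :
  has_diff (iota \o phi) w (fun v => v 0 0 *: dir (w 0 0)).
Proof. exact: has_diff_comp (diff_phi w) (diff_iota (phi w)). Qed.

Let iota_cont : continuous iota.
Proof. by move=> x; apply: differentiable_continuous; have [] := diff_iota x. Qed.

Let dir_cont : continuous dir.
Proof.
move=> x; apply: cvgD; first exact: cvg_cst.
apply: cvgZ; [exact: f'_cont|exact: cvg_cst].
Qed.

Let iota_inj : injective iota.
Proof. by move=> x y xy; rewrite -(pt0 x (f x)) -/(iota x) xy pt0. Qed.

Let param : local_param iota setT phi.
Proof.
split.
- split; first exact: openT.
  by move=> w w' _ _ ww'; apply/rowP => i; rewrite ord1.
- by move=> w _; exact: coord_continuous.
- move=> V oV _.
  have -> : phi @` V = (fun x : R => x *: (const_mx 1 : 'rV[R]_1)) @^-1` V.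
    apply/seteqP; split=> [_ [w Vw <-]|x /= Vx].
      have E : phi w *: (const_mx 1 : 'rV[R]_1) = w.
        by apply/rowP => i; rewrite !mxE mulr1 ord1.
      exact: (eq_ind_r V Vw E).
    by exists (x *: const_mx 1) => //; rewrite /phi !mxE mulr1.
  by apply: open_comp => // x _; exact: scalel_continuous.
- move=> w _; split; first by have [] := diff_param w.
  move=> v.
  have -> : 'D_v (iota \o phi) = (fun w => v 0 0 *: dir (w 0 0)).
    apply/funext => x; have [D E] := diff_param x.
    by rewrite deriveE // E.
  have cd : (fun w : 'rV[R]_1 => dir (w 0 0)) @ w --> dir (w 0 0).
    apply: (cvg_comp (fun w : 'rV[R]_1 => w 0 0) dir); last exact: dir_cont.
    exact: coord_continuous.
  exact: (cvgZ (cvg_cst (v 0 0)) cd).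
- move=> w _ v v'; have [_ E] := diff_param w; rewrite !E.
  move=> /(congr1 (fun z : plane => z 0 0)); 
  have E2 (k : R) (z : plane) : (k *: z) 0 0 = k * z 0 0 by rewrite mxE.
  rewrite !E2; have -> : dir (w 0 0) 0 0 = 1 by rewrite /dir pt0.
  by rewrite !mulr1 => vv; apply/rowP => i; rewrite ord1.
Qed.

Let form_dir (x : R) : form_app a (iota x) (dir x) = 0.
Proof.
have [D E] := diff_iota x; have [DF EF] := F_diff (iota x).
have H : 'd (F \o iota) x 1 = 0.
  have -> : F \o iota = cst c by apply/funext => y; exact: F_iota.
  by rewrite diff_cst.
move: H; rewrite diff_comp //= E scale1r EF => /eqP.
by rewrite mulf_eq0 (negbTE (mu_neq0 _)) => /eqP.
Qed.

Let iota_integral : integral_manifold setT a iota.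
Proof.
split.
- split; first exact: iota_inj.
  move=> x; exists setT, phi; split; first exact: param.
  by exists (const_mx x) => //; rewrite /phi mxE.
- by exists (iota 0), 0.
- by apply/connected_intervalP => x y _ _ z _.
- by [].
move=> x; apply/seteqP; split=> v.
- move=> [W [psi [w [[_ _ _ C1 _] Ww wx [u _ <-]]]]] /=.
  have [D _] := C1 w Ww; have [DF EF] := F_diff (iota (psi w)).
  have H : 'd (F \o (iota \o psi)) w u = 0.
    have -> : F \o (iota \o psi) = cst c by apply/funext => y; exact: F_iota.
    by rewrite diff_cst.
  move: H; rewrite diff_comp //= EF wx => /eqP.
  by rewrite mulf_eq0 (negbTE (mu_neq0 _)) => /eqP.
- move=> /= Hv; exists setT, phi, (const_mx x); split=> //.
    by rewrite /phi mxE.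
  exists (const_mx (v 0 0)) => //; have [_ ->] := diff_param (const_mx x).
  rewrite !mxE; move: Hv (form_dir x); rewrite !form_app2 !a_dy !mul1r.
  rewrite /dir pt0 pt1 mulr1 => Hv /eqP; rewrite addr_eq0 => /eqP Ha.
  apply: rV2P; rewrite mxE ?pt0 ?pt1 ?mulr1 //.
  by move/eqP: Hv; rewrite Ha addrC mulNr subr_eq0 => /eqP ->; rewrite mulrC.
Qed.

(** The graph of [f] is the level set [F = c] of a first integral of [a].  It is
    maximal because [F] is constant on every integral manifold, and it satisfies
    the condition of Rolle because a curve with endpoints on the graph satisfies
    Rolle's theorem for its composition with [F]. *)
Lemma rolle_leaf_graph : rolle_leaf setT a [set z | z 0 1 = f (z 0 0)].
Proof.
exists R, iota; split.
- by rewrite range_iota.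
- split; first exact: iota_integral.
  move=> Y kappa Hk sub; apply/seteqP; split=> // _ [y _ <-].
  have [y0 _ Hy0] : range kappa (iota 0) by apply: sub; exists 0.
  rewrite range_iota /=; apply/F_graph.
  by rewrite (first_integral_cst F_diff Hk y y0) Hy0 F_iota.
- split; first exact: iota_inj.
  move=> O; split=> [oO|[V oV ->]].
    exists ((fun z : plane => z 0 0) @^-1` O).
      by apply: open_comp => // z _; exact: coord_continuous.
    by apply/seteqP; split=> x /=; rewrite pt0.
  by apply: open_comp => // x _; exact: iota_cont.
- have E : [set z : plane | z 0 1 = f (z 0 0)] = F @^-1` [set c].
    by apply/seteqP; split=> z /= /F_graph.
  have cl : closed (F @^-1` [set c]).
    apply: preimage_closed; last exact: closed_eq.
    by move=> z _; apply: differentiable_continuous; have [] := F_diff z.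
  move=> z [Hz _]; apply/F_graph.
  have : closure (F @^-1` [set c]) z by rewrite -E; exact: Hz.
  by rewrite -(closure_id _).1.
- move=> g g' Hg _ /F_graph g0 /F_graph g1.
  have cF (s : plane) : {for s, continuous F}.
    by apply: differentiable_continuous; have [] := F_diff s.
  have dg (s : R) : s \in `]0, 1[ -> differentiable g s /\ 'd g s 1 = g' s.
    rewrite in_itv /= => /andP[s0 s1].
    have [D E] := C1_curve_is_derive Hg s0 s1.
    have D' : differentiable g s by apply/derivable1_diffP.
    by rewrite -deriveE.
  have dFg (s : R) : s \in `]0, 1[ -> differentiable (F \o g) s.
    by move=> /dg[D _]; apply: differentiable_comp => //; have [] := F_diff (g s).
  have [|||s s01 [_ Hs]] := @Rolle R (F \o g) 0 1 ltr01.
  + by move=> s /dFg ?; exact/derivable1_diffP.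
  + apply/continuous_within_itvP; first exact: ltr01.
    split.
    * by move=> s /dFg ?; exact: differentiable_continuous.
    * apply: (cvg_comp g F); last exact: cF.
      apply: (C1_curve_cvg _ Hg); first by rewrite in_itv /= lexx ler01.
      - move=> A HA.
        have {}HA : nbhs (0 : R) (fun r => r != 0 -> r \in `[0, 1] -> A r) by [].
        suff : nbhs (0 : R) (fun r => 0 < r -> A r) by [].
        have H1 : nbhs (0 : R) [set` `]-1, 1[].
          by apply: near_in_itvoo; rewrite in_itv /= ltrN10 ltr01.
        apply: filterS2 HA H1 => r HA; rewrite /= in_itv /= => /andP[_ r1] r0.
        by apply: HA; rewrite ?gt_eqF // in_itv /= !ltW.
      - by move=> A HA; apply: filterS HA => r Ar _.
    * apply: (cvg_comp g F); last exact: cF.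
      apply: (C1_curve_cvg _ Hg); first by rewrite in_itv /= lexx ler01.
      - move=> A HA.
        have {}HA : nbhs (1 : R) (fun r => r != 1 -> r \in `[0, 1] -> A r) by [].
        suff : nbhs (1 : R) (fun r => r < 1 -> A r) by [].
        have H1 : nbhs (1 : R) [set` `]0, 2[].
          by apply: near_in_itvoo; rewrite in_itv /= ltr01 ltr1n.
        apply: filterS2 HA H1 => r HA; rewrite /= in_itv /= => /andP[r0 _] r1.
        by apply: HA; rewrite ?lt_eqF // in_itv /= !ltW.
      - by move=> A HA; apply: filterS HA => r Ar _.
  + by rewrite /= g0 g1.
  exists s; first exact: subset_itv_oo_cc.
  have [D E] := dg s s01; have [DF EF] := F_diff (g s).
  move: Hs; rewrite deriveE; last exact: dFg.
  rewrite diff_comp //= E EF => /eqP.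
  by rewrite mulf_eq0 (negbTE (mu_neq0 _)) => /eqP.
Qed.

End RolleLeaf.

(** * Linear differential equations *)

Section LinearEquation.
Variable R : realType.
Local Notation plane := 'rV[R]_2.

Lemma has_diff_affine (G H : R -> R) (dG dH : R) (z : plane) :
  is_derive (z 0 0) 1 G dG -> is_derive (z 0 0) 1 H dH ->
  has_diff (fun z : plane => z 0 1 * G (z 0 0) + H (z 0 0)) z
    (fun v => v 0 1 * G (z 0 0) + (z 0 1 * dG + dH) * v 0 0).
Proof.
move=> HG HH.
have H0 := has_diff_coord (0 : 'I_1) (0 : 'I_2) z.
have H1 := has_diff_coord (0 : 'I_1) (1 : 'I_2) z.
apply: has_diff_ext (has_diffD (has_diffM H1 (has_diff_derive H0 HG))
  (has_diff_derive H0 HH)) _ => v.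
by ring.
Qed.

(** The solution [f] of the linear equation [y' = al x * y + be x] is a level set
    of [y * G x + H x], where [G] is an integrating factor: its differential is
    [G x] times the form [dy - (al x * y + be x) dx]. *)
Lemma linear_ode_leaf (N : expansion R) (al be dal dbe G H f : R -> R) (c : R) :
  (forall x : R, is_derive x 1 al (dal x)) -> continuous dal ->
  (forall x : R, is_derive x 1 be (dbe x)) -> continuous dbe ->
  (forall x : R, is_derive x 1 G (- al x * G x)) -> (forall x, 0 < G x) ->
  (forall x : R, is_derive x 1 H (- be x * G x)) ->
  (forall x : R, is_derive x 1 f (al x * f x + be x)) ->
  (forall x, f x * G x + H x = c) ->
  defn_pred N (fun e => e 2%N = - (e 1%N * al (e 0%N) + be (e 0%N))) ->
  rolle_leaf_over N [set z : plane | z 0 1 = f (z 0 0)].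
Proof.
move=> Dal Cal Dbe Cbe DG G0 DH Df fc Hk.
pose k (z : plane) := - (z 0 1 * al (z 0 0) + be (z 0 0)).
pose a (z : plane) : plane := pt (k z) 1.
have cont (K dK : R -> R) : (forall x : R, is_derive x 1 K (dK x)) -> continuous K.
  move=> DK x; apply/differentiable_continuous/derivable1_diffP.
  by have [] := DK x.
exists setT, a; split.
- split; first exact: openT.
  by apply: (defn_definable (defn_true N)).
- move=> i; apply: (defn_definable (P := fun e =>
    if i == 0 then e 2%N = - (e 1%N * al (e 0%N) + be (e 0%N)) else e 2%N = 1)).
    by case: eqP => // _; apply: defn_eq; [exact: defn_term_var|exact: defn_term_cst].
  move=> v e He /=.
  have E0 : lsubmx v 0 0 = e 0%N by rewrite mxE -(He (lshift 1 (0 : 'I_2))).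
  have E1 : lsubmx v 0 1 = e 1%N by rewrite mxE -(He (lshift 1 (1 : 'I_2))).
  have E2 : rsubmx v ord0 ord0 = e 2%N by rewrite mxE -(He (rshift 2 (0 : 'I_1))).
  have Ea : a (lsubmx v) ord0 i =
      if i == 0 then - (e 1%N * al (e 0%N) + be (e 0%N)) else 1.
    rewrite -E0 -E1; case: eqP => [->|/eqP i0]; first exact: pt0.
    have -> : i = 1 by case: i i0 => -[|[|//]] Hi //= _; apply: val_inj.
    exact: pt1.
  rewrite E2; split=> [[_]|Hi]; last split=> //; rewrite Ea; first by case: ifP.
  by move: Hi; case: ifP.
- move=> z _.
  have da (w : plane) : has_diff a w (fun v =>
      - (v 0 1 * al (w 0 0) + (w 0 1 * dal (w 0 0) + dbe (w 0 0)) * v 0 0) *: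
      delta_mx 0 0).
    have dk := has_diffN (has_diff_affine (Dal (w 0 0)) (Dbe (w 0 0))).
    apply: has_diff_ext (has_diffD (has_diffZl _ dk) (has_diff_cst _ w)) _ => v.
    by rewrite addr0.
  split; first by have [] := da z.
  move=> v.
  have -> : 'D_v a = (fun w : plane => - (v 0 1 * al (w 0 0) +
      (w 0 1 * dal (w 0 0) + dbe (w 0 0)) * v 0 0) *: (delta_mx 0 0 : plane)).
    apply/funext => w; have [D E] := da w.
    by rewrite deriveE // E.
  have c0 (K : R -> R) : continuous K -> (fun w : plane => K (w 0 0)) @ z --> K (z 0 0).
    move=> cK; apply: (cvg_comp (fun w : plane => w 0 0) K); last exact: cK.
    exact: coord_continuous.
  have cal := c0 _ (cont _ _ Dal); have cdal := c0 _ Cal; have cdbe := c0 _ Cbe.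
  have cz : (fun w : plane => w 0 1) @ z --> z 0 1 by exact: coord_continuous.
  have cs : (fun w : plane => - (v 0 1 * al (w 0 0) +
      (w 0 1 * dal (w 0 0) + dbe (w 0 0)) * v 0 0)) @ z -->
      - (v 0 1 * al (z 0 0) + (z 0 1 * dal (z 0 0) + dbe (z 0 0)) * v 0 0).
    exact: (cvgN (cvgD (cvgM (cvg_cst _) cal)
      (cvgM (cvgD (cvgM cz cdal) cdbe) (cvg_cst _)))).
  exact: (cvgZ cs (cvg_cst (delta_mx 0 0 : plane))).
- move=> z _; apply/negP => /eqP /(congr1 (fun z : plane => z 0 1)).
  by rewrite /a pt1 mxE => /eqP; rewrite oner_eq0.
apply: (rolle_leaf_graph (f' := fun x => al x * f x + be x) (mu := fun z => G (z 0 0))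
  (F := fun z => z 0 1 * G (z 0 0) + H (z 0 0)) (c := c)) => //.
- move=> x; apply: cvgD; last exact: (cont _ _ Dbe).
  by apply: cvgM; [exact: (cont _ _ Dal)|exact: (cont _ _ Df)].
- by move=> z; rewrite /a pt1.
- move=> z; apply: has_diff_ext (has_diff_affine (DG (z 0 0)) (DH (z 0 0))) _ => v.
  rewrite form_app2 /a pt0 pt1 /k; ring.
- by move=> z; rewrite gt_eqF.
- move=> z; rewrite -(fc (z 0 0)); split=> [|->//].
  move=> /addIr /mulIf; apply; by rewrite gt_eqF.
Qed.

End LinearEquation.

(** * Gaussian measures and Brownian motion *)

Section Gaussian.
Variable R : realType.
Local Notation mu := (@lebesgue_measure R).
Implicit Types (a b t c x y s : R) (A E : set (measurableTypeR R)).

(** The rays form an intersection-stable generator of the Borel sets. *)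
Lemma prob_eq_rays (P Q : probability (measurableTypeR R) R) :
  (forall x, P `]-oo, x]%classic = Q `]-oo, x]%classic) ->
  forall A, measurable A -> P A = Q A.
Proof.
move=> PQ; apply: (@measure_unique _ R (measurableTypeR R) (@RGenOInfty.G R)
  (fun k => `]- k%:R, +oo[%classic)) => //.
- exact: RGenOInfty.measurableE.
- move=> _ _ [x ->] [y ->]; exists (Num.max x y).
  by apply/seteqP; split=> z /=; rewrite !in_itv /= !andbT gt_max => /andP.
- by move=> k; exists (- k%:R).
- rewrite -subTset => x _; exists (Num.truncn `|x|).+1 => //=.
  rewrite in_itv /= andbT ltrNl; apply: le_lt_trans (truncnS_gt _).
  by rewrite -normrN ler_norm.
- move=> _ [x ->].
  have PC (S : probability (measurableTypeR R) R) :
      S `]x, +oo[%classic = (1 - S `]-oo, x]%classic)%E.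
    by rewrite -setCitvl; apply: probability_setC.
  by have EP := PC P; rewrite PQ -PC in EP; exact: EP.
- by move=> k; rewrite (le_lt_trans (probability_le1 P _)) // ltry.
Qed.

Lemma normal_pdf_std a s x : 0 < s ->
  normal_pdf a s x = normal_pdf 0 1 ((x - a) / s) / s.
Proof.
move=> s0; rewrite !normal_pdfE ?gt_eqF // mulrAC; congr (_ * _).
  rewrite /normal_peak expr1n mul1r -mulrnAr sqrtrM ?sqr_ge0 //.
  by rewrite sqrtr_sqr gtr0_norm // invfM mulrC.
congr expR; rewrite subr0 expr1n; field.
by rewrite gt_eqF.
Qed.

Lemma is_derive_affine a s x : is_derive (x : R) 1 (fun x => (x - a) / s) s^-1.
Proof.
have D : is_derive (x : R) 1 (fun x => x - a) (1 - 0) by exact: is_deriveB.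
have := is_deriveM D (is_derive_cst s^-1 x 1).
by rewrite subr0 scaler0 add0r /GRing.scale /= mulr1.
Qed.

Lemma normal_prob_ray a s c : 0 < s ->
  normal_prob a s `]-oo, c]%classic = normal_prob 0 1 `]-oo, (c - a) / s]%classic.
Proof.
move=> s0; rewrite /normal_prob.
pose L (x : R) := (x - a) / s.
have DL (x : R) : is_derive x 1 L s^-1 by exact: is_derive_affine.
have dL : L^`()%classic = cst s^-1.
  by apply/funext => x; rewrite derive1E; apply: derive_val.
have cL : continuous L.
  move=> x; apply/differentiable_continuous/derivable1_diffP.
  by have [] := DL x.
rewrite -/(L c).
rewrite (@increasing_ge0_integration_by_substitutionNy R L (normal_pdf 0 1) c).
- apply: eq_integral => x _; congr (_%:E).
  by rewrite dL !fctE /= normal_pdf_std.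
- by move=> x y _ _ xy; rewrite /L ltr_pM2r ?invr_gt0 // ltrD2r.
- by rewrite dL => x _; exact: cvg_cst.
- by rewrite dL; exact: is_cvg_cst.
- by rewrite dL; exact: cvg_cst.
- split; first by move=> x _; have [] := DL x.
  exact: (cvg_at_left_filter (cL c)).
- apply: gt0_cvgMlNy; first by rewrite invr_gt0.
  exact: cvg_addrr_Ny.
- by apply: continuous_subspaceT; exact: continuous_normal_pdf.
- by move=> x _; exact: normal_pdf_ge0.
Qed.

(** Both sides are probability measures in [A], and they agree on rays. *)
Lemma normal_prob_translate a s A : 0 < s -> measurable A ->
  normal_prob 0 s [set x | A (x + a)] = normal_prob a s A.
Proof.
move=> s0 mA.
pose f (x : measurableTypeR R) : measurableTypeR R := x + a.
have mf : measurable_fun setT f by exact: measurable_funD.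
pose fM := isMeasurableFun.Build _ _ _ _ f mf.
pose X : {mfun measurableTypeR R >-> measurableTypeR R} := HB.pack f fM.
have H : forall c, distribution (normal_prob 0 s) X `]-oo, c]%classic =
    normal_prob a s `]-oo, c]%classic.
  move=> c; have E1 := normal_prob_ray a c s0.
  have E2 := normal_prob_ray 0 (c - a) s0; rewrite subr0 in E2.
  apply: etrans (esym (etrans E1 (esym E2))).
  rewrite /distribution /pushforward; congr normal_prob.
  by apply/seteqP; split=> x /=; rewrite !in_itv /= lerBrDr.
exact: (prob_eq_rays H mA).
Qed.

Lemma gauss_integral_onE A a t : measurable A -> 0 < t ->
  (gauss_integral_on A a t)%:E = normal_prob a (Num.sqrt t) A.
Proof.
move=> mA t0; have s0 : 0 < Num.sqrt t by rewrite sqrtr_gt0.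
have pdfE x : normal_pdf a (Num.sqrt t) x =
    (Num.sqrt (2 * pi * t))^-1 * expR (- ((x - a) ^+ 2 / (2 * t))).
  rewrite normal_pdfE ?gt_eqF //; congr (_ * _).
    rewrite /normal_peak sqr_sqrtr ?ltW //; congr (Num.sqrt _)^-1; ring.
  by rewrite /normal_fun sqr_sqrtr ?ltW // mulNr; congr (expR (- (_ / _))); ring.
have int : mu.-integrable A (fun x => (normal_pdf a (Num.sqrt t) x)%:E).
  by apply: (integrableS measurableT mA (@subsetT _ A)) => //;
    exact: integrable_normal_pdf.
rewrite /gauss_integral_on /normal_prob.
have peak0 : (Num.sqrt (2 * pi * t))^-1 != 0 :> R.
  by rewrite invr_eq0 sqrtr_eq0 -ltNge !mulr_gt0 // pi_gt0.
have -> : \int[mu]_(x in A) expR (- ((x - a) ^+ 2 / (2 * t))) =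
   Num.sqrt (2 * pi * t) * \int[mu]_(x in A) normal_pdf a (Num.sqrt t) x.
  rewrite -RintegralZl //; apply: eq_Rintegral => x _.
  by rewrite pdfE mulrA -[X in X * _ * _]invrK mulVf // mul1r.
rewrite mulrA mulVf ?mul1r; last by rewrite -invr_eq0.
rewrite /Rintegral fineK //; exact: integrable_fin_num.
Qed.

Lemma gauss_integral_on01 A a t : measurable A -> 0 < t ->
  0 <= gauss_integral_on A a t <= 1.
Proof.
move=> mA t0; rewrite -!lee_fin gauss_integral_onE //.
rewrite measure_ge0 /=.
exact: (probability_le1 (normal_prob a (Num.sqrt t) : probability _ R)).
Qed.

Lemma gauss_integral_onU A E a t : measurable A -> measurable E -> 0 < t ->
  (forall x, A x -> E x -> False) ->
  gauss_integral_on (A `|` E) a t = gauss_integral_on A a t + gauss_integral_on E a t.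
Proof.
move=> mA mE t0 AE; apply: EFin_inj.
rewrite EFinD !gauss_integral_onE //; last exact: measurableU.
apply: measureU => //; apply/seteqP; split=> x // [Ax Ex]; exact: (AE x).
Qed.

Lemma gauss_integral_on_set1 x a t : 0 < t -> gauss_integral_on [set x] a t = 0.
Proof.
by move=> t0; rewrite /gauss_integral_on Rintegral_set1 mulr0.
Qed.

Lemma gauss_integral_on_le A E a t : measurable A -> measurable E -> 0 < t ->
  A `<=` E -> gauss_integral_on A a t <= gauss_integral_on E a t.
Proof.
move=> mA mE t0 AE; rewrite -lee_fin !gauss_integral_onE //.
by apply: le_measure => //; rewrite inE.
Qed.

Definition Phi x : R := gauss_integral_on `]-oo, x]%classic 0 1.

Lemma measurable_ray c : measurable (`]-oo, c]%classic : set (measurableTypeR R)).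
Proof. exact: measurable_itv. Qed.

Lemma PhiE x : (Phi x)%:E = normal_prob 0 1 `]-oo, x]%classic.
Proof.
have := gauss_integral_onE 0 (measurable_ray x) ltr01.
by rewrite sqrtr1.
Qed.

Lemma gauss_integral_on_ray c a t : 0 < t ->
  gauss_integral_on `]-oo, c]%classic a t = Phi ((c - a) / Num.sqrt t).
Proof.
move=> t0; apply: EFin_inj; apply: etrans (gauss_integral_onE a (measurable_ray c) t0) _.
have s0 : 0 < Num.sqrt t by rewrite sqrtr_gt0.
by rewrite PhiE; apply: normal_prob_ray.
Qed.

Lemma is_derive_Phi (x : R) : is_derive x 1 Phi (normal_pdf 0 1 x).
Proof.
have -> : Phi = fun y => \int[mu]_(u in `]-oo, y]%classic) normal_pdf 0 1 u.
  apply/funext => y; apply: EFin_inj.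
  apply: etrans (PhiE y) _; rewrite /Rintegral fineK //.
  apply: integrable_fin_num => //.
  by apply: (integrableS measurableT _ (@subsetT _ _)) => //;
    exact: integrable_normal_pdf.
have [||||D E] := @continuous_FTC1 R (normal_pdf 0 1) -oo%O x (x + 1).
- by rewrite ltrDl.
- by apply: (integrableS measurableT _ (@subsetT _ _)) => //;
    exact: integrable_normal_pdf.
- by rewrite ltNyr.
- by apply: continuous_normal_pdf.
by apply: DeriveDef; [exact: D|rewrite -derive1E; exact: E].
Qed.

(** The position at time [t] is almost surely [a] plus an increment, whose law is
    a centred normal law. *)
Lemma brownian_motion_law d (T : measurableType d) (P : probability T R)
    (B : R -> T -> R) a t A : brownian_motion P a B -> 0 < t -> measurable A ->
  P [set w | A (B t w)] = (gauss_integral_on A a t)%:E.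
Proof.
move=> [mB B0 incr _ _] t0 mA.
have mAa : measurable [set x | A (x + a)].
  have : measurable_fun setT (fun x : measurableTypeR R => x + a : measurableTypeR R).
    exact: measurable_funD.
  by move=> /(_ measurableT A mA); rewrite setTI.
have := incr 0 t; rewrite lexx t0 => /(_ isT _ mAa).
rewrite subr0 normal_prob_translate ?sqrtr_gt0 // -gauss_integral_onE // => <-.
have [N [mN PN0 HN]] := B0.
have mBt : measurable_fun setT (B t) by apply: mB; exact: ltW.
have mS1 : measurable [set w | A (B t w)].
  by have := mBt measurableT A mA; rewrite setTI.
have mS2 : measurable [set w | A (B t w - B 0 w + a)].
  have : measurable_fun setT (fun w => B t w - B 0 w).
    by apply: measurable_funB => //; exact: mB.
  by move=> /(_ measurableT _ mAa); rewrite setTI.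
have B0N w : ~ N w -> B 0 w = a.
  by move=> Nw; apply: contrapT => H; apply: Nw; exact: HN.
have le S1 S2 : measurable S1 -> measurable S2 -> S1 `<=` S2 `|` N ->
    (P S1 <= P S2)%E.
  move=> m1 m2 S12; rewrite -[leRHS]adde0 -PN0.
  apply: (le_trans _ (measureU2 _ m2 mN)).
  by apply: le_measure; rewrite ?inE //; exact: measurableU.
apply/eqP; rewrite eq_le; apply/andP; split; apply: le => // w /= Aw.
- have [Nw|Nw] := pselect (N w); [by right|left].
  by rewrite (B0N w Nw) /= subrK.
- have [Nw|Nw] := pselect (N w); [by right|left].
  by move: Aw; rewrite (B0N w Nw) /= subrK.
Qed.

End Gaussian.

(** * The normal distribution function in the Pfaffian closure *)

Section GaussianLeaves.
Variable R : realType.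
Local Notation plane := 'rV[R]_2.
Local Notation density := (@normal_pdf R 0 1).

Lemma densityE x : density x = normal_peak 1 * expR (- (x * x / 2)).
Proof.
rewrite normal_pdfE ?oner_neq0 // /normal_fun; congr (_ * expR _).
by rewrite subr0 expr1n; field.
Qed.

Lemma is_derive_expR_quad (b x : R) :
  is_derive x 1 (fun x => expR (b * (x * x / 2))) (b * x * expR (b * (x * x / 2))).
Proof.
have D1 : is_derive x 1 (fun x : R => b * (x * x / 2)) (b * x).
  have D2 := is_deriveM (is_derive_id x 1) (is_derive_id x 1).
  have D3 := is_deriveM (is_derive_cst b x 1)
    (is_deriveM D2 (is_derive_cst (2^-1 : R) x 1)).
  apply: (is_derive_eq D3); by rewrite /GRing.scale /=; field.
have D := @is_derive1_comp R expR (fun x => b * (x * x / 2)) x _ _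
  (is_derive_expR _) D1.
by apply: (is_derive_eq D); rewrite mulrC.
Qed.

Lemma is_derive_density (x : R) : is_derive x 1 density (- x * density x).
Proof.
have -> : density = fun x => normal_peak 1 * expR (-1 * (x * x / 2)).
  by apply/funext => y; rewrite densityE mulN1r.
have D := is_deriveM (is_derive_cst (normal_peak 1 : R) x 1) (is_derive_expR_quad (-1) x).
by apply: (is_derive_eq D); rewrite /GRing.scale /=; ring.
Qed.

(** The density solves [y' = - x * y]. *)
Lemma density_leaf (N : expansion R) :
  rolle_leaf_over N [set z : plane | z 0 1 = density (z 0 0)].
Proof.
apply: (linear_ode_leaf (al := fun x => - x) (be := fun=> 0) (dal := fun=> -1)
  (dbe := fun=> 0) (G := fun x => expR (1 * (x * x / 2))) (H := fun=> 0)
  (f := density) (c := normal_peak 1)).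
- by move=> x; exact: cvg_cst.
- by move=> x; exact: cvg_cst.
- move=> x; apply: (is_derive_eq (is_derive_expR_quad 1 x)); ring.
- by move=> x; exact: expR_gt0.
- move=> x; apply: (is_derive_eq (is_derive_cst 0 x 1)); ring.
- move=> x; apply: (is_derive_eq (is_derive_density x)); ring.
- move=> x; rewrite addr0 densityE mul1r -[LHS]mulrA -expRD addNr expR0 mulr1 //.
- apply: defn_eq; first exact: defn_term_var.
  apply/defn_term_opp/defn_term_add; last exact: defn_term_cst.
  by apply: defn_term_mul; [exact: defn_term_var|apply: defn_term_opp; exact: defn_term_var].
Qed.

Lemma defn_graph (N : expansion R) (f : R -> R) t1 t2 :
  N 2%N [set z : plane | z 0 1 = f (z 0 0)] -> defn_term t1 -> defn_term t2 ->
  defn_pred N (fun e => t1 e = f (t2 e)).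
Proof.
move=> Nf d1 d2.
have dts (i : 'I_2) : defn_term (if i == 0 then t2 else t1) by case: ifP.
apply: defn_ext (definable_defn (definable_prim Nf) dts) => e.
by rewrite /= !mxE.
Qed.

(** The form [dy - density x dx] has definable coefficients only after the graph
    of the density has been added to the structure. *)
Lemma Phi_leaf (N : expansion R) :
  rolle_leaf_over (add_rolle_leaves N) [set z : plane | z 0 1 = Phi (z 0 0)].
Proof.
have cdens : continuous density by apply: continuous_normal_pdf; rewrite oner_neq0.
apply: (linear_ode_leaf (al := fun=> 0) (be := density) (dal := fun=> 0)
  (dbe := fun x => - x * density x) (G := fun=> 1) (H := fun x => - Phi x)
  (f := @Phi R) (c := 0)).
- by move=> x; exact: cvg_cst.
- exact: is_derive_density.
- by move=> x; apply: cvgM; [apply: cvgN; exact: cvg_id|exact: cdens].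
- move=> x; apply: (is_derive_eq (is_derive_cst (1 : R) x 1)); ring.
- by move=> x.
- move=> x; apply: (is_derive_eq (is_deriveN (is_derive_Phi x))); ring.
- move=> x; apply: (is_derive_eq (is_derive_Phi x)); ring.
- move=> x; ring.
- apply: (@defn_ext _ _ (fun e => exists y, y = density (e 0%N) /\
    e 2%N = - (e 1%N * 0 + y))).
    move=> e; split=> [[y [Hy He]]|He]; first by rewrite He Hy.
    by exists (density (e 0%N)).
  apply: defn_ex; apply: defn_and.
    apply: defn_graph; [exact: (or_intror (density_leaf N))|exact: defn_term_var|].
    exact: defn_term_var.
  by dfn.
Qed.

Lemma defn_Phi (M : expansion R) t1 t2 : defn_term t1 -> defn_term t2 ->
  defn_pred (pfaffian_closure M) (fun e => t1 e = Phi (t2 e)).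
Proof.
move=> d1 d2; apply: defn_graph => //.
(* the second stage of the closure *)
by exists 2%N; exact: (or_intror (Phi_leaf M)).
Qed.

End GaussianLeaves.

(** * The mass of a finite union of intervals *)

Section PiecewiseIntegral.
Variable R : realType.
Implicit Types (a s x y w : R) (k K : nat).
Local Notation borel := (set (measurableTypeR R)).

Definition Phi_std a s x : R := Phi ((x - a) / s).

Definition above (S : set R) y : set R := S `&` `]y, +oo[%classic.

(** A first-order description, for a set [S] with at most [k] jumps beyond [y], of
    the mass [w] of [above S y] for the normal law of mean [a] and standard
    deviation [s].  No jump lies strictly between [y] and [y'], so there [S] contains
    everything or nothing, which is tested at the midpoint.  The choice
    [y' = y] serves the case that fewer than [k] jumps are left. *)
Fixpoint tail_spec (S : R -> Prop) a s k y w : Prop :=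
  match k with
  | 0%N => (forall x, y < x -> loc_const S x) /\
      exists q, q = Phi_std a s y /\
        ((S (y + 1) /\ w = 1 - q) \/ (~ S (y + 1) /\ w = 0))
  | k'.+1 => exists y', exists w', tail_spec S a s k' y' w' /\
      (y <= y' /\ (forall x, y < x -> x < y' -> loc_const S x) /\
       exists q, exists q', q = Phi_std a s y /\ q' = Phi_std a s y' /\
         ((S ((y + y') / 2) /\ w = w' + (q' - q)) \/
          (~ S ((y + y') / 2) /\ w = w')))
  end.

Definition mass_spec (S : R -> Prop) a s k w : Prop :=
  exists y, exists w', tail_spec S a s k y w' /\
    ((forall x, x < y -> loc_const S x) /\
     exists q, q = Phi_std a s y /\
       ((S (y - 1) /\ w = w' + q) \/ (~ S (y - 1) /\ w = w'))).

Section Mass.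
Variables (S : set R) (a s : R).
Hypothesis s0 : 0 < s.
Hypothesis mS : measurable (S : borel).

Let g (E : set R) := gauss_integral_on E a (s ^+ 2).

Let t0 : 0 < s ^+ 2. Proof. by rewrite exprn_gt0. Qed.

Let mItv (I : interval R) : measurable ([set` I] : borel).
Proof. exact: measurable_itv. Qed.

Let gray y : g `]-oo, y]%classic = Phi_std a s y.
Proof.
by rewrite /g gauss_integral_on_ray // sqrtr_sqr gtr0_norm.
Qed.

Let gU (A B C : set R) : measurable (A : borel) -> measurable (B : borel) ->
  (forall x, A x -> B x -> False) -> (forall x, C x <-> A x \/ B x) ->
  g C = g A + g B.
Proof.
move=> mA mB AB CE; have -> : C = A `|` B by apply/seteqP; split=> x /CE.
exact: gauss_integral_onU.
Qed.

Let gpt (E : set R) y : measurable (E : borel) -> (forall x, E x -> x = y) -> g E = 0.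
Proof.
move=> mE Ey; apply/eqP; rewrite eq_le.
have /andP[-> _] := gauss_integral_on01 a mE t0; rewrite andbT.
rewrite -(gauss_integral_on_set1 y a t0); exact: gauss_integral_on_le.
Qed.

Let goc y y' : y <= y' -> g `]y, y']%classic = Phi_std a s y' - Phi_std a s y.
Proof.
move=> yy'; rewrite -!gray.
rewrite (@gU `]-oo, y]%classic `]y, y']%classic `]-oo, y']%classic).
- by rewrite addrAC subrr add0r.
- exact: mItv.
- exact: mItv.
- by move=> x /=; rewrite !in_itv /=; lra.
- move=> x /=; rewrite !in_itv /=; split=> [xy'|[xy|/andP[]//]].
    by have [?|?] := leP x y; [left|right].
  exact: le_trans yy'.
Qed.

Let goy y : g `]y, +oo[%classic = 1 - Phi_std a s y.
Proof.
have T1 : g setT = 1.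
  apply: EFin_inj; rewrite /g gauss_integral_onE //; exact: probability_setT.
rewrite -T1 -gray (@gU `]-oo, y]%classic `]y, +oo[%classic setT).
- by rewrite addrAC subrr add0r.
- exact: mItv.
- exact: mItv.
- by move=> x /=; rewrite !in_itv /=; lra.
- move=> x; split=> // _; rewrite /= !in_itv /= andbT.
  by have [?|?] := leP x y; [left|right].
Qed.

Let gray_const y : (forall x, x < y -> loc_const S x) ->
  g (S `&` `]-oo, y]%classic) = if pselect (S (y - 1)) then Phi_std a s y else 0.
Proof.
move=> Hl.
have const x : x < y -> (S x <-> S (y - 1)).
  move=> xy; have [xz|zx] := leP x (y - 1).
    by apply: loc_const_segment => // u _ uy; apply: Hl; lra.
  by apply: iff_sym; apply: (loc_const_segment (S := S) (ltW zx)) => u _ uy; apply: Hl; lra.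
case: pselect => Sm.
- rewrite -gray; apply/eqP; rewrite eq_le; apply/andP; split.
    by apply: gauss_integral_on_le => //; exact: measurableI.
  rewrite (@gU (`]-oo, y]%classic `&` S) (`]-oo, y]%classic `\` S)).
  + rewrite setIC (@gpt (_ `\` _) y) ?addr0 //; first exact: measurableD.
    move=> x [/=]; rewrite in_itv /= le_eqVlt => /orP[/eqP//|xy] nS.
    by case: nS; apply/const.
  + exact: measurableI.
  + exact: measurableD.
  + by move=> x [_ ?] [_].
  + by move=> x; split=> [|[[]|[]]//] H; have [?|?] := pselect (S x); [left|right].
- apply: (@gpt _ y); first exact: measurableI.
  move=> x [Sx /=]; rewrite in_itv /= le_eqVlt => /orP[/eqP//|xy].
  by case: Sm; apply/(const x xy).
Qed.

Let goc_const y y' : y <= y' -> (forall x, y < x -> x < y' -> loc_const S x) ->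
  g (S `&` `]y, y']%classic) =
  if pselect (S ((y + y') / 2)) then Phi_std a s y' - Phi_std a s y else 0.
Proof.
move=> yy' Hl.
have const x : y < x -> x < y' -> (S x <-> S ((y + y') / 2)).
  move=> yx xy'; have [xz|zx] := leP x ((y + y') / 2).
    by apply: loc_const_segment => // u xu uy; apply: Hl; lra.
  by apply: iff_sym; apply: (loc_const_segment (S := S) (ltW zx)) => u xu uy; apply: Hl; lra.
case: pselect => Sm.
- rewrite -goc //; apply/eqP; rewrite eq_le; apply/andP; split.
    by apply: gauss_integral_on_le => //; exact: measurableI.
  rewrite (@gU (`]y, y']%classic `&` S) (`]y, y']%classic `\` S)).
  + rewrite setIC (@gpt (_ `\` _) y') ?addr0 //; first exact: measurableD.
    move=> x [/=]; rewrite in_itv /= le_eqVlt => /andP[yx /orP[/eqP//|xy]] nS.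
    by case: nS; apply/const.
  + exact: measurableI.
  + exact: measurableD.
  + by move=> x [_ ?] [_].
  + by move=> x; split=> [|[[]|[]]//] H; have [?|?] := pselect (S x); [left|right].
- apply: (@gpt _ y'); first exact: measurableI.
  move=> x [Sx /=]; rewrite in_itv /= le_eqVlt => /andP[yx /orP[/eqP//|xy]].
  by case: Sm; apply/(const x yx xy).
Qed.

Let goy_const y : (forall x, y < x -> loc_const S x) ->
  g (above S y) = if pselect (S (y + 1)) then 1 - Phi_std a s y else 0.
Proof.
move=> Hl.
have const x : y < x -> (S x <-> S (y + 1)).
  move=> yx; have [xz|zx] := leP x (y + 1).
    by apply: loc_const_segment => // u xu _; apply: Hl; lra.
  by apply: iff_sym; apply: (loc_const_segment (S := S) (ltW zx)) => u xu _; apply: Hl; lra.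
case: pselect => Sm.
- rewrite -goy; congr g; apply/seteqP; split=> x; first by case.
  move=> Hx; split=> //; apply/const => //.
  by move: Hx; rewrite /= in_itv /= andbT.
- apply: (@gpt _ y); first exact: measurableI.
  move=> x [Sx /=]; rewrite in_itv /= andbT => yx.
  by case: Sm; apply/(const x yx).
Qed.

Let tail_split y y' : y <= y' ->
  g (above S y) = g (above S y') + g (S `&` `]y, y']%classic).
Proof.
move=> yy'; rewrite addrC; apply: gU.
- exact: measurableI.
- exact: measurableI.
- by move=> x [_ /=] + [_ /=]; rewrite !in_itv /=; lra.
- move=> x; rewrite /above /= !in_itv /= !andbT; split=> [[Sx yx]|].
    by have [?|?] := leP x y'; [left|right]; rewrite ?yx.
  by move=> [[? /andP[]]|[? ?]]; split=> //; exact: le_lt_trans yy' _.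
Qed.

Lemma tail_spec_sound k y w : tail_spec S a s k y w -> w = g (above S y).
Proof.
elim: k y w => [|k IH] y w /=.
- move=> [Hl [q [-> Hw]]]; rewrite goy_const //.
  by case: pselect => Sm; case: Hw => -[].
- move=> [y' [w' [/IH -> [yy' [Hl [q [q' [-> [-> Hw]]]]]]]]].
  rewrite (tail_split yy') goc_const //.
  by case: pselect => Sm; case: Hw => -[] // _ ->; rewrite ?addr0.
Qed.

Lemma tail_spec_complete k y : tame S ->
  at_most k (fun x => y < x /\ ~ loc_const S x) ->
  tail_spec S a s k y (g (above S y)).
Proof.
move=> tS; elim: k y => [|k IH] y Hk /=.
- have Hl x : y < x -> loc_const S x.
    move=> yx; apply: contrapT => nl.
    have : (size [:: x] <= 0)%N; last by [].
    by apply: Hk => // z; rewrite inE => /eqP ->.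
  split=> //; exists (Phi_std a s y); split=> //.
  by rewrite goy_const //; case: pselect => ?; [left|right].
- have [y' [yy' Hl Hk']] : exists y', [/\ y <= y',
      (forall x, y < x -> x < y' -> loc_const S x) &
      at_most k (fun x => y' < x /\ ~ loc_const S x)].
    have [l [_ Hl]] := fin_seq tS.
    have [Hy|[b [bl yb Hb]]] := seq_succ l y.
      exists y; split=> // [x yx xy|t ut Ht]; first lra.
      case: t ut Ht => [//|x t] _ /(_ x (mem_head _ _)) [yx /Hl /Hy]; lra.
    exists b; split; first exact: ltW.
      move=> x yx xb; apply: contrapT => /Hl xl.
      by have := Hb _ xl yx; lra.
    move=> t ut Ht; apply: (Hk (b :: t)) => /=.
      rewrite ut andbT; apply/negP => /Ht[]; lra.
    move=> x; rewrite inE => /orP[/eqP ->|/Ht[bx nl]].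
      by split=> //; apply/Hl.
    by split=> //; exact: lt_trans bx.
  exists y', (g (above S y')); split; first exact: IH.
  split=> //; split=> //; exists (Phi_std a s y), (Phi_std a s y'); do 2 split=> //.
  rewrite (tail_split yy') goc_const //.
  by case: pselect => ?; [left|right]; rewrite ?addr0.
Qed.

(** Up to a null set, [S] is a union of some of the intervals between consecutive
    jumps. *)
Lemma mass_specP k w : tame S -> at_most k (fun x => ~ loc_const S x) ->
  mass_spec S a s k w <-> w = gauss_integral_on S a (s ^+ 2).
Proof.
move=> tS Hk; rewrite -/(g S).
have split_at y : (forall x, x < y -> loc_const S x) ->
    g S = g (above S y) + if pselect (S (y - 1)) then Phi_std a s y else 0.
  move=> Hl; rewrite -gray_const // addrC; apply: gU.
  - exact: measurableI.
  - exact: measurableI.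
  - by move=> x [_ /=] + [_ /=]; rewrite !in_itv /=; lra.
  - move=> x; rewrite /above /= !in_itv /= !andbT; split=> [Sx|[[]|[]]//].
    by have [?|?] := leP x y; [left|right].
split=> [[y [w' [Ht [Hl [q [-> Hw]]]]]]|->].
  rewrite (split_at y Hl) -(tail_spec_sound Ht).
  by case: pselect => ?; case: Hw => -[] // _ ->; rewrite ?addr0.
have [l Hl] := tS.
have [y Hy] : exists y, forall x, x \in l -> y < x.
  elim: l {Hl} => [|c l [y Hy]]; first by exists 0.
  have [yc|cy] := ltP y c.
    by exists y => x; rewrite inE => /orP[/eqP ->|/Hy].
  exists (c - 1) => x; rewrite inE => /orP[/eqP ->|/Hy]; lra.
have lc x : x < y -> loc_const S x.
  by move=> xy; apply: contrapT => /Hl /Hy; lra.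
exists y, (g (above S y)); split.
  apply: tail_spec_complete => // t ut Ht; apply: Hk => // x /Ht[] //.
split=> //; exists (Phi_std a s y); split=> //.
by rewrite (split_at y lc); case: pselect => ?; [left|right]; rewrite ?addr0.
Qed.

End Mass.
End PiecewiseIntegral.

(** * Definability of the parameterized integral *)

Section MassDefinable.
Variables (R : realType) (N : expansion R) (P : R -> (nat -> R) -> Prop).
Hypothesis HP : defn_family N P.
Hypothesis HPhi : forall t1 t2 : (nat -> R) -> R, defn_term t1 -> defn_term t2 ->
  defn_pred N (fun e => t1 e = Phi (t2 e)).

(** Uses [HP] and [HPhi] for the atomic formulas that are not polynomial, and
    leaves occurrences of [tail_spec] as goals. *)
Ltac dfn_atoms := repeat lazymatch goal with
  | |- defn_pred _ (fun e => _ = Phi _) => apply: HPhi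
  | |- defn_pred _ (fun e => P _ _) => apply: (defn_app HP) => [|?]
  | |- _ => dfn_step
  end.

Ltac dfn_leaf := solve
  [ assumption
  | match goal with
    | H : defn_term ?t |- defn_term (fun e => ?t _) => apply: (defn_term_subst H) => ?; exact: defn_term_var
    | H : forall i, defn_term _ |- _ => first
       [ exact: H | apply: (defn_term_subst (H _)) => ?; exact: defn_term_var ]
    end ].

Lemma defn_tail_spec k (sg : (nat -> R) -> nat -> R) ta ts ty tw :
  (forall i, defn_term (fun e => sg e i)) ->
  defn_term ta -> defn_term ts -> defn_term ty -> defn_term tw ->
  defn_pred N (fun e => tail_spec (fun x => P x (sg e)) (ta e) (ts e) k (ty e) (tw e)).
Proof.
elim: k sg ta ts ty tw => [|k IH] sg ta ts ty tw Hsg Ha Hs Hy Hw /=; rewrite /Phi_std.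
  by dfn_atoms; dfn_leaf.
dfn_atoms; try dfn_leaf.
by apply: IH => *; first [exact: defn_term_var | dfn_leaf].
Qed.

Lemma defn_mass_spec k (sg : (nat -> R) -> nat -> R) ta ts tw :
  (forall i, defn_term (fun e => sg e i)) -> defn_term ta -> defn_term ts -> defn_term tw ->
  defn_pred N (fun e => mass_spec (fun x => P x (sg e)) (ta e) (ts e) k (tw e)).
Proof.
move=> Hsg Ha Hs Hw; rewrite /mass_spec /Phi_std.
dfn_atoms; try dfn_leaf.
by apply: defn_tail_spec => *; first [exact: defn_term_var | dfn_leaf].
Qed.

End MassDefinable.

Section Family.
Variables (R : realType) (M : expansion R).
Hypothesis oM : o_minimal M.

Lemma defn_measurable P e : defn_family M P ->
  measurable ([set x | P x e] : set (measurableTypeR R)).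
Proof.
move=> HP; have [|I ->] := oM (S := [set x | P x e]).
  exact: definable_fiber.
elim: I => [|I l IH]; first by rewrite big_nil; exact: measurable0.
by rewrite big_cons; apply: measurableU => //; exact: measurable_itv.
Qed.

Variables (p : nat) (A : set 'rV[R]_(p + 1)).
Hypothesis dA : definable M A.

(** The first [p] variables of the environment are the coordinates of the base
    point of the slice. *)
Definition slice_family (x : R) (e : nat -> R) : Prop :=
  A (\row_(i < p + 1) if (i < p)%N then e i else x).

Lemma slice_familyE (u : 'rV[R]_p) (e : nat -> R) :
  (forall i : 'I_p, e i = u ord0 i) -> slice A u = [set x | slice_family x e].
Proof.
move=> He; apply/funext => x; rewrite /slice /slice_family /=; congr A.
apply/rowP => i; rewrite !mxE; case: splitP => j ij.
  by rewrite ij He.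
by rewrite mxE ord1.
Qed.

Lemma defn_slice_family : defn_family M slice_family.
Proof.
pose ts (i : 'I_(p + 1)) (e : nat -> R) := if (i < p)%N then e i.+1 else e 0%N.
have dts i : defn_term (ts i) by rewrite /ts; case: (i < p)%N; exact: defn_term_var.
exact: (definable_defn dA dts).
Qed.

(** Each slice has finitely many jumps, and the jumps form a definable family. *)
Lemma slice_family_jumps : exists K, forall e,
  at_most K (fun x => ~ loc_const (fun z => slice_family z e) x).
Proof.
have HB : defn_family M (fun x e => ~ loc_const (fun z => slice_family z e) x).
  by apply: defn_not; apply: (defn_loc_const defn_slice_family).
apply: (uniform_finiteness (p := p) oM HB) => [y e e' ee'|e].
- suff -> : (fun z => slice_family z e) = (fun z => slice_family z e') by [].
  apply/funext => z; rewrite /slice_family; congr A.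
  by apply/rowP => i; rewrite !mxE; case: ifP => // /ee'.
- exact: defn_tame defn_slice_family.
Qed.

End Family.

Theorem theoremA (R : realType) (M : expansion R) (oM : o_minimal M)
    (p : nat) (A : set 'rV[R]_(p + 1)) (dA : definable M A) :
  (forall (u : 'rV[R]_p) (a t : R), 0 < t ->
     0 <= gauss_integral_on (slice A u) a t <= 1 /\
     forall (d : measure_display) (T : measurableType d) (P : probability T R)
       (B : R -> T -> R), brownian_motion P a B ->
       P [set w | slice A u (B t w)] =
         (gauss_integral_on (slice A u) a t)%:E) /\
  definable_fun (pfaffian_closure M)
    [set z : 'rV[R]_(p + 1 + 1) | 0 < rsubmx z ord0 ord0]
    (fun z : 'rV[R]_(p + 1 + 1) =>
       let u := lsubmx (lsubmx z) in
       let a := rsubmx (lsubmx z) ord0 ord0 in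
       let t := rsubmx z ord0 ord0 in
       gauss_integral_on (slice A u) a t).
Proof.
have HF := defn_slice_family dA.
split=> [u a t t0|].
  pose e (i : nat) := if insub i is Some j then u ord0 j else 0.
  have He (i : 'I_p) : e i = u ord0 i by rewrite /e valK.
  have mS : measurable (slice A u : set (measurableTypeR R)).
    by rewrite (slice_familyE A He); exact: (defn_measurable oM e HF).
  split=> [|d T P B HB]; first exact: gauss_integral_on01.
  exact: brownian_motion_law.
have [K HK] := slice_family_jumps oM dA.
have HFP : defn_family (pfaffian_closure M) (slice_family A).
  by apply: defn_expand HF => n S MS; exists 0%N.
(* [s] is the square root of the time, and [K] bounds the number of jumps *)
pose Q (e : nat -> R) := 0 < e p.+1 /\ exists s, 0 < s /\ s * s = e p.+1 /\
  mass_spec (fun x => slice_family A x e) (e p) s K (e p.+2).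
have HQ : defn_pred (pfaffian_closure M) Q.
  rewrite /Q; apply: defn_and; first by dfn.
  apply: defn_ex => /=; apply: defn_and; first by dfn.
  apply: defn_and; first by dfn.
  have dPhi t1 t2 := @defn_Phi R M t1 t2.
  apply: (@defn_mass_spec _ _ _ HFP dPhi K (fun e i => e i.+1)
    (fun e => e p.+1) (fun e => e 0%N) (fun e => e p.+3)) => *; exact: defn_term_var.
apply: (defn_definable HQ) => v e He /=.
have Et : rsubmx (lsubmx v) ord0 ord0 = e p.+1.
  rewrite !mxE -He /=; congr e; lia.
have Ea : rsubmx (lsubmx (lsubmx v)) ord0 ord0 = e p.
  by rewrite !mxE -He /= addn0.
have Ew : rsubmx v ord0 ord0 = e p.+2.
  rewrite !mxE -He /=; congr e; lia.
have Eu (i : 'I_p) : e i = lsubmx (lsubmx (lsubmx v)) ord0 i.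
  by rewrite !mxE -He.
rewrite Et Ea Ew (slice_familyE A Eu) /Q.
have tS := defn_tame oM e HF.
have mS := defn_measurable oM e HF.
split=> [[t0 Hw]|[t0 [s [s0 [st Hw]]]]]; split=> //.
  exists (Num.sqrt (e p.+1)); split; first by rewrite sqrtr_gt0.
  split; first by rewrite -expr2 sqr_sqrtr // ltW.
  apply/(mass_specP _ _ mS _ tS (HK e)); first by rewrite sqrtr_gt0.
  by rewrite sqr_sqrtr // ltW.
by have := (mass_specP _ s0 mS _ tS (HK e)).1 Hw; rewrite expr2 st.
Qed.
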